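(* Let $0<\alpha<1$, $1<p<\infty$, $T>0$, $\lambda\ge0$, and let $\omega\in A_p$ be a Muckenhoupt weight on $(0,T)$. Then there exists a constant $C>0$, independent of $\tau$, such that the following holds. Let $f$ be a continuous source term on $[0,T]$, let $y_0\in\mathbb{R}$, and suppose that the exact solution $y$ of $$D^\alpha y(t)+\lambda y(t)=f(t),\quad t\in(0,T],\qquad y(0)=y_0,$$ satisfies $y\in W^{2,p}_\omega(0,T)$. For an integer $N\ge1$ put $\tau=T/N$, $t_n=n\tau$, and let $Y_0,\dots,Y_N$ be the numerical solution defined by $Y_0=y_0$ and $$\delta_\tau^\alpha Y_n+\lambda Y_n=f(t_n),\qquad n=1,\dots,N.$$ Then the global error $e_n=y(t_n)-Y_n$ satisfies $$\max_{1\le n\le N}|e_n|\le C\,\tau^{2-\alpha-1/p}\,\Lambda(\omega,\tau)\,\|y\|_{W^{2,p}_\omega},$$ where $$\Lambda(\omega,\tau)=\sup_{0\le j\le N-1}\left(\frac1\tau\int_{t_j}^{t_{j+1}}\omega(s)^{-\frac1{p-1}}\,ds\right)^{\frac{p-1}{p}}.$$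
   Context: A weight is a locally integrable function $\omega:(0,T)\to[0,\infty)$. The weighted space $L^p_\omega(0,T)$ has norm $\|y\|_{L^p_\omega}=\left(\int_0^T|y(t)|^p\omega(t)\,dt\right)^{1/p}$. The weighted Sobolev space is $W^{s,p}_\omega(0,T)=\{y\in L^p_\omega(0,T): y',\dots,y^{(s)}\in L^p_\omega(0,T)\}$ (weak derivatives) with norm $\|y\|_{W^{s,p}_\omega}=\left(\int_0^T\left(\sum_{k=0}^s|y^{(k)}(t)|^p\right)\omega(t)\,dt\right)^{1/p}$. For $1<p<\infty$, $\omega$ belongs to the Muckenhoupt class $A_p$ on $(0,T)$ if $$[\omega]_{A_p}:=\sup_{J\subset(0,T)}\left(\frac1{|J|}\int_J\omega(t)\,dt\right)\left(\frac1{|J|}\int_J\omega(t)^{-\frac1{p-1}}dt\right)^{p-1}<\infty,$$ the supremum being over all subintervals $J$ of $(0,T)$, with the convention $0\cdot\infty=\infty$ (so $\omega\equiv0$ is excluded and both $\omega$ and $\omega^{-1/(p-1)}$ are integrable on $(0,T)$). Functions $y\in W^{2,p}_\omega(0,T)$ are identified with their continuously differentiable representatives on $[0,T]$ (with $y'$ absolutely continuous). The Caputo derivative of order $\alpha\in(0,1)$ is $D^\alpha y(t)=\frac1{\Gamma(1-\alpha)}\int_0^t\frac{y'(s)}{(t-s)^\alpha}\,ds$. The L1 operator acts on a grid function $(Y_0,\dots,Y_N)$, for $n\ge1$, by $$\delta_\tau^\alpha Y_n=\frac{\tau^{-\alpha}}{\Gamma(2-\alpha)}\left(Y_n-b_{n-1}Y_0-\sum_{i=1}^{n-1}(b_{n-i-1}-b_{n-i})Y_i\right),\qquad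 b_i=(i+1)^{1-\alpha}-i^{1-\alpha}.$$ *)

(* Defs.v *)
From HB Require Import structures.
From mathcomp Require Import all_boot all_order all_algebra.
From mathcomp Require Import all_classical all_reals all_analysis.
Set Implicit Arguments.
Unset Strict Implicit.
Unset Printing Implicit Defensive.
Import Order.TTheory GRing.Theory Num.Theory.
Import numFieldNormedType.Exports.
Local Open Scope classical_set_scope.
Local Open Scope ring_scope.

Section weights.
Context {R : realType}.
Local Notation mu := (@lebesgue_measure R).
Local Open Scope ereal_scope.

Definition weight (D : set R) (omega : R -> R) : Prop :=
  locally_integrable D omega /\ forall t, D t -> (0 <= omega t)%R.

(* omega ^ (- 1 / (p - 1)) with values in [0, +oo]; powR sends 0 to 0 for any
   nonzero exponent, so the value +oo at the zeros of omega is set by hand. *)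
Definition dual_weight (p : R) (omega : R -> R) (t : R) : \bar R :=
  if omega t == 0%R then +oo
  else (omega t `^ (- (1 / (p - 1))))%R%:E.

Definition average (A : set R) (g : R -> \bar R) : \bar R :=
  ((fine (mu A))^-1)%:E * \int[mu]_(t in A) g t.

(* Product on [0, +oo] with the convention 0 * +oo = +oo
   (the library's product has 0 * +oo = 0). *)
Definition mule_infty (x y : \bar R) : \bar R :=
  if (x == +oo) || (y == +oo) then +oo else x * y.

Definition Ap_constant (T p : R) (omega : R -> R) : \bar R :=
  ereal_sup [set z | exists J : interval R,
    [/\ [set` J] `<=` `]0%R, T[, 0 < mu [set` J] &
     z = mule_infty (average [set` J] (EFin \o omega))
                    (average [set` J] (dual_weight p omega) `^ (p - 1))]].

Definition muckenhoupt (T p : R) (omega : R -> R) : Prop :=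
  weight `]0%R, T[ omega /\ Ap_constant T p omega < +oo.

Definition Lp_weighted (D : set R) (p : R) (omega y : R -> R) : Prop :=
  measurable_fun D y /\
  \int[mu]_(t in D) (`|y t| `^ p * omega t)%R%:E < +oo.

End weights.

Section weighted_sobolev.
Context {R : realType}.
Local Notation mu := (@lebesgue_measure R).

Definition test_function (D : set R) (phi : R -> R) : Prop :=
  (forall (k : nat) (x : R), derivable phi^`(k)%classic x 1) /\
  exists K : set R,
    [/\ compact K, K `<=` D & forall x, ~ K x -> phi x = 0].

Definition is_weak_derivative (D : set R) (k : nat) (u g : R -> R) : Prop :=
  [/\ locally_integrable D u, locally_integrable D g &
   forall phi, test_function D phi ->
     \int[mu]_(t in D) (u t * phi^`(k)%classic t)
       = (- 1) ^+ k * \int[mu]_(t in D) (g t * phi t)].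

(* The k-th weak derivative, defined up to a null set: a chosen representative
   (0 if there is none). For k = 0 it is u almost everywhere on D. *)
Definition weak_derivative (D : set R) (k : nat) (u : R -> R) : R -> R :=
  xget (cst 0) [set g | is_weak_derivative D k u g].

Definition weighted_sobolev (D : set R) (s : nat) (p : R) (omega y : R -> R) :
    Prop :=
  forall k : nat, (k <= s)%N ->
    (exists g, is_weak_derivative D k y g) /\
    Lp_weighted D p omega (weak_derivative D k y).

Definition sobolev_norm (D : set R) (s : nat) (p : R) (omega y : R -> R) :
    \bar R :=
  ((\int[mu]_(t in D)
     ((\sum_(k < s.+1) `|weak_derivative D k y t| `^ p) * omega t)%:E)
   `^ p^-1)%E.

Definition absolutely_continuous (a b : R) (g : R -> R) : Prop :=
  forall e : R, 0 < e -> exists2 d : R, 0 < d &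
    forall (n : nat) (u v : 'I_n -> R),
      (forall i, a <= u i /\ u i <= v i /\ v i <= b) ->
      trivIset [set: 'I_n] (fun i => [set` `]u i, v i[]) ->
      \sum_(i < n) (v i - u i) < d ->
      \sum_(i < n) `|g (v i) - g (u i)| < e.

(* y is C^1 on [0, T] with y' absolutely continuous on [0, T]. The classical
   derivative is taken in the open interval, because y is unconstrained outside
   [0, T]; dy extends it to the end points, where it is then the one-sided
   derivative of y. *)
Definition C1_representative (T : R) (y : R -> R) : Prop :=
  [/\ {within `[0, T], continuous y},
      forall t, t \in `]0, T[ -> derivable y t 1 &
      exists dy : R -> R,
        [/\ {within `[0, T], continuous dy},
            absolutely_continuous 0 T dy &
            forall t, t \in `]0, T[ -> y^`()%classic t = dy t]].

End weighted_sobolev.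

Section fractional.
Context {R : realType}.
Local Notation mu := (@lebesgue_measure R).

Definition Gamma (x : R) : R :=
  \int[mu]_(t in `]0, +oo[) (t `^ (x - 1) * expR (- t)).

Definition caputo (alpha : R) (y : R -> R) (t : R) : R :=
  (Gamma (1 - alpha))^-1 *
  \int[mu]_(s in `]0, t[) (y^`()%classic s / (t - s) `^ alpha).

Definition exact_solution (alpha lambda T y0 : R) (f y : R -> R) : Prop :=
  (forall t, t \in `]0, T] -> caputo alpha y t + lambda * y t = f t) /\
  y 0 = y0.

Definition L1_coef (alpha : R) (i : nat) : R :=
  i.+1%:R `^ (1 - alpha) - i%:R `^ (1 - alpha).

(* Meaningful for n >= 1 only. *)
Definition L1_op (alpha tau : R) (Y : nat -> R) (n : nat) : R :=
  tau `^ (- alpha) / Gamma (2 - alpha) *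
  (Y n - L1_coef alpha (n - 1) * Y 0%N
   - \sum_(1 <= i < n)
       (L1_coef alpha (n - i - 1) - L1_coef alpha (n - i)) * Y i).

Definition numerical_solution (alpha lambda tau y0 : R) (f : R -> R) (N : nat)
    (Y : nat -> R) : Prop :=
  Y 0%N = y0 /\
  forall n : nat, (1 <= n <= N)%N ->
    L1_op alpha tau Y n + lambda * Y n = f (n%:R * tau).

Definition Lambda (p : R) (omega : R -> R) (tau : R) (N : nat) : \bar R :=
  ereal_sup (range (fun j : 'I_N =>
    (((tau^-1)%:E * \int[mu]_(s in `](j%:R * tau)%R, (j.+1%:R * tau)%R[)
        dual_weight p omega s) `^ ((p - 1) / p))%E)).

End fractional.

(* Main.v *)
Require Import Defs.
From HB Require Import structures.
From mathcomp Require Import all_boot all_order all_algebra.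
From mathcomp Require Import all_classical all_reals all_analysis.
From mathcomp Require Import measurable_realfun.
From mathcomp Require Import ring lra.
Import Order.TTheory GRing.Theory Num.Theory.
Import numFieldNormedType.Exports.
Local Open Scope classical_set_scope.
Local Open Scope ring_scope.

(** The error e_n = y(t_n) - Y_n satisfies the L1 scheme with right-hand side
    the truncation error r_n. Since the weights b_i decrease and
    b_(n-1) >= (1 - alpha) n^(-alpha), induction on n gives
    |e_n| <= C t_n^alpha max |r_m|.
    On each cell I_j, |y'(s) - y'(r)| <= int_{I_j} |y''|, which Hoelder's
    inequality with the weight bounds by
    B = ||y|| Lambda tau^(1 - 1/p). The difference of the slope of y on I_j and
    of y' has mean zero on I_j, so the kernel k(s) = (t_n - s)^(-alpha) may be
    replaced by k - k(t_j) there: the contribution of I_j to r_n is at most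
    B tau (k(t_(j+1)) - k(t_j)), which telescopes to B tau^(1 - alpha); the last
    cell, where k is singular, contributes at most B tau^(1 - alpha)/(1 - alpha).
    The bound on the oscillation of y' comes from testing the weak second
    derivative against a smooth function that rises from 0 to 1 just before r
    and falls back to 0 just after s. *)

(** * Smooth steps *)

(** Bounding every cell by [B] times the integral of k would only give a truncation error of order
    B: the power tau^(1 - alpha) comes entirely from subtracting k(t_j) against a factor of mean
    zero. Hoelder's inequality contributes tau^(1 - 1/p), and stability costs no power of tau
    because t_n <= T, so the exponents add up to 2 - alpha - 1/p. The second derivative in the norm
    is a chosen representative of a weak derivative, so it can be compared with the classical y'
    only through test functions. These must be infinitely differentiable with compact support, hence
    the construction from exp(-1/x). The A_p condition enters through J = (0, T): the dual weight is
    integrable there, so omega is nonzero almost everywhere and Lambda is finite. Gamma is given by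
    its integral; its positivity and Gamma(2 - alpha) = (1 - alpha) Gamma(1 - alpha) are needed to
    match the normalisation of the scheme with that of the Caputo derivative. *)

Lemma is_derive_quad (R : realType) (f : R -> R) (a C : R) :
  (forall x, `|f x - f a| <= C * (x - a) ^+ 2) -> is_derive a 1 f 0.
Proof.
move=> fC.
have h : h^-1 *: (f (h *: 1 + a) - f a) @[h --> 0^'] --> (0 : R).
  apply/cvgrPdist_le => e e0.
  have C0 : 0 <= C.
    by have := fC (1 + a); rewrite addrK expr1n mulr1; apply: le_trans.
  near=> h.
  have h0 : h != 0 by near: h; exact: nbhs_dnbhs_neq.
  rewrite sub0r normrN normrZ normfV ler_pdivrMl ?normr_gt0//.
  apply: (le_trans (fC _)).
  rewrite [h *: 1]mulr1 addrK -real_normK ?num_real// expr2 mulrCA ler_wpM2l//.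
  have : `|h| <= e / (C + 1).
    near: h; apply: dnbhs0_le; rewrite divr_gt0// ltr_wpDl//.
  rewrite ler_pdivlMr ?ltr_wpDl// => /(le_trans _); apply.
  by rewrite mulrC ler_wpM2l// lerDl.
by split; [apply/cvg_ex; exists 0|apply: cvg_lim].
Unshelve. all: by end_near. Qed.

Section ndiff.
Context {R : realType}.
Implicit Types f g : R -> R.

(** The derivative is carried as a witness, so that closure under sums, products and composition
    follows by induction on [n] without any formula for an iterated derivative. *)
Fixpoint ndiff (n : nat) f : Prop :=
  if n is m.+1 then
    exists2 f' : R -> R, (forall x : R, is_derive x 1 f (f' x)) & ndiff m f'
  else True.

Definition smooth f := forall n, ndiff n f.

Lemma ndiffW n f : ndiff n.+1 f -> ndiff n f.
Proof.
by elim: n f => [//|n IH] f [f' df nf']; exists f' => //; exact: IH.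
Qed.

Lemma ndiff_cst n (c : R) : ndiff n (fun=> c).
Proof. by elim: n c => [//|n IH] c; exists (fun=> 0) => // x; exact: is_derive_cst.
Qed.

Lemma ndiffD n f g : ndiff n f -> ndiff n g -> ndiff n (fun x => f x + g x).
Proof.
elim: n f g => [//|n IH] f g [f' df nf] [g' dg ng].
by exists (fun x => f' x + g' x); [move=> x; exact: is_deriveD|exact: IH].
Qed.

Lemma ndiffM n f g : ndiff n f -> ndiff n g -> ndiff n (fun x => f x * g x).
Proof.
elim: n f g => [//|n IH] f g nf ng; have [f' df nf'] := nf; have [g' dg ng'] := ng.
exists (fun x => f x * g' x + g x * f' x); first by move=> x; exact: is_deriveM.
by apply: ndiffD; apply: IH => //; exact: ndiffW.
Qed.

Lemma ndiff_comp n f g : ndiff n f -> ndiff n g -> ndiff n (fun x => f (g x)).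
Proof.
elim: n f g => [//|n IH] f g nf ng; have [f' df nf'] := nf; have [g' dg ng'] := ng.
exists (fun x => f' (g x) * g' x).
  move=> x; have dgx := dg x; have dfg := df (g x).
  exact: is_derive1_comp.
by apply: ndiffM => //; apply: IH => //; exact: ndiffW.
Qed.

Lemma smooth_affine (a b : R) : smooth (fun x => a * x + b).
Proof.
case=> [//|n]; exists (fun=> a); last exact: ndiff_cst.
move=> x; have -> : (fun x0 => a * x0 + b) = (a *: id + cst b : R -> R) by [].
apply: is_derive_eq.
by rewrite addr0 [_ *: _]mulr1.
Qed.

Lemma smooth_derivable f k (x : R) : smooth f -> derivable f^`(k)%classic x 1.
Proof.
move=> /(_ k.+1); elim: k f => [|k IH] f [f' df nf'].
  by rewrite derive1n0.
have -> : f^`(k.+1)%classic = f'^`(k)%classic; last exact: IH.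
rewrite derive1Sn; congr (_^`(_)%classic).
by apply/funext => y; rewrite derive1E derive_val.
Qed.

Lemma smooth_continuous f : smooth f -> continuous f.
Proof.
move=> /(_ 1%N) [f' df _] x; apply: differentiable_continuous.
by apply/derivable1_diffP; have := df x.
Qed.

Lemma smooth_derive1 f : smooth f ->
  (forall x : R, is_derive x 1 f (f^`()%classic x)) /\ smooth f^`()%classic.
Proof.
move=> sf; have dE f' : (forall x : R, is_derive x 1 f (f' x)) -> f^`()%classic = f'.
  by move=> df; apply/funext => y; rewrite derive1E derive_val.
split; first by have [f' df _] := sf 1%N; rewrite (dE _ df).
by move=> n; have [f' df nf'] := sf n.+1; rewrite (dE _ df).
Qed.

End ndiff.

Section flat.
Context {R : realType}.
Implicit Type P : {poly R}.

Definition flat P (x : R) : R :=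
  if 0 < x then P.[x^-1] * expR (- x^-1) else 0.

(** Raise u / n <= 1 + u / n <= exp(u / n) to the power n. *)
Lemma expr_le_expR n (u : R) : 0 <= u -> u ^+ n <= n%:R ^+ n * expR u.
Proof.
move=> u0; case: n => [|n].
  by rewrite !expr0 mul1r -expR0 ler_expR.
have -> : expR u = expR (u / n.+1%:R) ^+ n.+1.
  by rewrite -expRM_natl mulrC divfK// pnatr_eq0.
rewrite -exprMn lerXn2r// ?nnegrE ?mulr_ge0 ?expR_ge0//.
rewrite mulrC -ler_pdivrMr ?ltr0n//.
by apply: le_trans (expR_ge1Dx _); rewrite lerDr.
Qed.

(** The factor [u ^+ n] serves the induction on the polynomial: the ['X] of a leading part [P * 'X]
    is absorbed into it. *)
Lemma poly_le_expR P n : exists2 C : R, 0 <= C &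
  forall u, 0 <= u -> `|u ^+ n * P.[u]| <= C * expR u.
Proof.
elim/poly_ind: P n => [|P c IH] n.
  by exists 0 => // u _; rewrite horner0 mulr0 normr0 mul0r.
have [C C0 CP] := IH n.+1.
exists (C + `|c| * n%:R ^+ n).
  by rewrite addr_ge0// mulr_ge0// exprn_ge0.
move=> u u0; rewrite hornerMXaddC mulrDr mulrDl.
apply: (le_trans (ler_normD _ _)); apply: lerD.
  by rewrite (mulrC _ u) mulrA -exprSr CP.
rewrite normrM mulrC -mulrA ler_wpM2l// ger0_norm ?exprn_ge0//.
exact: expr_le_expR.
Qed.

Lemma is_derive_flat P (x : R) : is_derive x 1 (flat P) (flat ('X^2 * (P - P^`())) x).
Proof.
have [x0|x0|->] := ltgtP x 0.
- rewrite [X in is_derive _ _ _ X](_ : _ = 0); last by rewrite /flat ltNge (ltW x0).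
  have : is_derive x 1 (cst (0 : R)) (0 : R) by exact: is_derive_cst.
  apply: near_eq_is_derive.
  near=> y; rewrite /flat ltNge.
  suff -> : y <= 0 by [].
  by apply/ltW; near: y; exact: lt_nbhsl.
- have dV : is_derive x 1 (fun y : R => y^-1) (- x^-2).
    apply: is_derive_eq; first by apply: is_deriveV; rewrite gt_eqF.
    by rewrite [_ *: _]mulr1.
  have dP : is_derive x 1 (fun y : R => P.[y^-1]) (P^`().[x^-1] * (- x^-2)).
    exact: (@is_derive1_comp _ _ _ _ _ _ (is_derive_poly P _) dV).
  have dE : is_derive x 1 (fun y : R => expR (- y^-1)) (expR (- x^-1) * x^-2).
    have dN : is_derive x 1 (fun y : R => - y^-1) (x^-2).
      by rewrite -[x^-2]opprK; exact: (is_deriveN dV).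
    exact: (is_derive1_comp (is_derive_expR _) dN).
  have := is_deriveM dP dE.
  rewrite (_ : _ *: _ + _ *: _ = flat ('X^2 * (P - P^`())) x); last first.
    rewrite /flat x0 hornerM hornerXn hornerD hornerN exprVn.
    by have sE (a b : R) : a *: (b : R^o) = a * b by []; rewrite !sE; ring.
  apply: near_eq_is_derive.
  near=> y; rewrite /flat.
  suff -> : 0 < y by [].
  by near: y; exact: lt_nbhsr.
- rewrite [X in is_derive _ _ _ X](_ : _ = 0); last by rewrite /flat ltxx.
  (* With u = 1/y and exponent 2 the bound reads |[flat P y]| <= C y^2, so the difference quotient
     at 0 tends to 0. *)
  have [C C0 CP] := poly_le_expR P 2.
  apply: (@is_derive_quad _ _ _ C) => y.
  rewrite /flat ltxx !subr0; case: ifPn => y0; last first.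
    by rewrite normr0 mulr_ge0// sqr_ge0.
  have yi : 0 <= y^-1 by rewrite invr_ge0 ltW.
  rewrite normrM (ger0_norm (expR_ge0 _)) expRN ler_pdivrMr ?expR_gt0//.
  have := CP _ yi; rewrite normrM exprVn [`|_^-1|]ger0_norm ?invr_ge0 ?sqr_ge0//.
  by rewrite ler_pdivrMl ?exprn_gt0// mulrA (mulrC C).
Unshelve. all: by end_near. Qed.

Lemma smooth_flat P : smooth (flat P).
Proof.
move=> n; elim: n P => [//|n IH] P.
by exists (flat ('X^2 * (P - P^`()))) => //; exact: is_derive_flat.
Qed.

Lemma flat_le0 P x : x <= 0 -> flat P x = 0.
Proof. by rewrite /flat leNgt => /negbTE ->. Qed.

Lemma flat1_ge0 x : 0 <= flat 1 x.
Proof. by rewrite /flat; case: ifPn => // _; rewrite hornerC mul1r expR_ge0. Qed.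

Lemma le_flat1 : {homo flat 1 : x y / x <= y}.
Proof.
move=> x y xy; have [x0|x0] := leP x 0; first by rewrite flat_le0// flat1_ge0.
have y0 := lt_le_trans x0 xy.
by rewrite /flat x0 y0 !hornerC !mul1r ler_expR lerN2 lef_pV2.
Qed.

(* flat 1 vanishes on the negative axis and increases, so flat 1 1 - flat 1 x is
   nonpositive for x >= 1: composing flat 1 with itself gives a monotone step
   without integrating a bump function. *)
Definition smoothstep (x : R) : R :=
  1 - flat 1 (flat 1 1 - flat 1 x) / flat 1 (flat 1 1).

Let flat11_gt0 : 0 < flat 1 1.
Proof. by rewrite /flat ltr01 hornerC mul1r expR_gt0. Qed.

Let c_gt0 : 0 < flat 1 (flat 1 1).
Proof. by rewrite {1}/flat flat11_gt0 hornerC mul1r expR_gt0. Qed.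

Lemma smooth_smoothstep : smooth smoothstep.
Proof.
have -> : smoothstep = (fun x => - (flat 1 (flat 1 1))^-1 *
    flat 1 ((-1) * flat 1 x + flat 1 1) + 1).
  apply/funext => x; rewrite /smoothstep mulN1r (addrC (- _) (flat 1 1)).
  by rewrite mulNr [RHS]addrC [X in _ = 1 - X]mulrC.
move=> n; apply: (ndiff_comp _ _ _ (smooth_affine _ 1 n)).
apply: (ndiff_comp _ _ _ (smooth_flat 1 n)).
exact: (ndiff_comp _ _ _ (smooth_affine _ _ n) (smooth_flat 1 n)).
Qed.

Lemma smoothstep_le0 x : x <= 0 -> smoothstep x = 0.
Proof. by move=> x0; rewrite /smoothstep (flat_le0 _ x)// subr0 divff ?subrr// gt_eqF. Qed.

Lemma smoothstep_ge1 x : 1 <= x -> smoothstep x = 1.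
Proof.
move=> x1; rewrite /smoothstep [flat 1 (_ - _)]flat_le0 ?mul0r ?subr0//.
by rewrite subr_le0 le_flat1.
Qed.

Lemma le_smoothstep : {homo smoothstep : x y / x <= y}.
Proof.
move=> x y xy; rewrite /smoothstep lerD2l lerN2 ler_wpM2r ?invr_ge0 ?(ltW c_gt0)//.
by rewrite le_flat1// lerD2l lerN2 le_flat1.
Qed.

End flat.

(** * Averaging against the derivative of a step *)

Section within_continuous.
Context {R : realType} (A : set R).
Implicit Types f g : R -> R.

Lemma within_continuous_cst (k : R) : {within A, continuous (fun=> k : R)}.
Proof. by apply: continuous_subspaceT => x; exact: cvg_cst. Qed.

Lemma within_continuousM f g : {within A, continuous f} ->
  {within A, continuous g} -> {within A, continuous (fun x => f x * g x)}.
Proof. by move=> cf cg x; exact: (continuousM (cf x) (cg x)). Qed.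

Lemma within_continuousB f g : {within A, continuous f} ->
  {within A, continuous g} -> {within A, continuous (fun x => f x - g x)}.
Proof. by move=> cf cg x; exact: (continuousB (cf x) (cg x)). Qed.

Lemma within_continuous_norm f : {within A, continuous f} ->
  {within A, continuous (fun x => `|f x|)}.
Proof.
by move=> cf x; apply: continuous_comp; [exact: cf|exact: norm_continuous].
Qed.

End within_continuous.

Lemma ndecr_is_derive_ge0 {R : realType} (f : R -> R) (x d : R) :
  {homo f : a b / a <= b} -> is_derive x 1 f d -> 0 <= d.
Proof.
move=> fnd [df <-]; apply: limr_ge; first exact: df.
near=> h; have h0 : h != 0 by near: h; exact: nbhs_dnbhs_neq.
rewrite [h *: 1]mulr1; have [hn|hp] : h < 0 \/ 0 < h by apply/orP; rewrite -neq_lt.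
- apply: mulr_le0; first by rewrite invr_le0 ltW.
  by rewrite subr_le0 fnd// gerDr ltW.
- apply: mulr_ge0; first by rewrite invr_ge0 ltW.
  by rewrite subr_ge0 fnd// lerDr ltW.
Unshelve. all: by end_near. Qed.

Lemma derive1_open_cst {R : realType} (f : R -> R) (U : set R) (k : R) :
  open U -> {in U, forall x, f x = k} -> {in U, forall x, f^`()%classic x = 0}.
Proof.
move=> oU fk x xU; rewrite derive1E (@near_eq_derive _ _ _ f (cst k)) ?derive_cst//.
by near=> y; apply: fk; rewrite inE; near: y; apply: open_nbhs_nbhs; split => //; exact: set_mem.
Unshelve. all: by end_near. Qed.

Section step_at.
Context {R : realType}.
Notation mu := (@lebesgue_measure R).

(** For e > 0 the rise takes place on [c, c + e]. The argument (t - c) / e is expanded to have the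
    shape required by [smooth_affine]. *)
Definition step_at (c e t : R) : R := smoothstep (e^-1 * t + - (e^-1 * c)).

Lemma smooth_step_at c e : smooth (step_at c e).
Proof.
by move=> n; exact: (ndiff_comp _ _ _ (smooth_smoothstep n) (smooth_affine _ _ n)).
Qed.

Variables c e : R.
Hypothesis e0 : 0 < e.

Let step_arg t : e^-1 * t + - (e^-1 * c) = (t - c) / e.
Proof. by rewrite -mulrBr mulrC. Qed.

Lemma step_at_le t : t <= c -> step_at c e t = 0.
Proof.
by move=> tc; rewrite /step_at step_arg smoothstep_le0// pmulr_lle0 ?invr_gt0// subr_le0.
Qed.

Lemma step_at_ge t : c + e <= t -> step_at c e t = 1.
Proof.
move=> tc; rewrite /step_at step_arg smoothstep_ge1// ler_pdivlMr// mul1r.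
by rewrite lerBrDl.
Qed.

Lemma le_step_at : {homo step_at c e : x y / x <= y}.
Proof.
move=> x y xy; rewrite /step_at le_smoothstep// lerD2r ler_wpM2l// invr_ge0.
exact: ltW.
Qed.

Lemma step_at_ge0 t : 0 <= step_at c e t.
Proof.
have [/step_at_le ->//|/ltW ct] := leP t c.
by rewrite -(step_at_le c (lexx c)) le_step_at.
Qed.

Lemma step_at_le1 t : step_at c e t <= 1.
Proof.
have [/step_at_ge ->//|/ltW ct] := leP (c + e) t.
by rewrite -(step_at_ge _ (lexx (c + e))) le_step_at.
Qed.

Lemma step_at_derive_ge0 t : 0 <= (step_at c e)^`()%classic t.
Proof.
apply: (ndecr_is_derive_ge0 _ _ _ le_step_at).
by have [+ _] := smooth_derive1 _ (smooth_step_at c e); exact.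
Qed.

Lemma step_at_derive_out t : t < c \/ c + e < t -> (step_at c e)^`()%classic t = 0.
Proof.
case=> ht.
- apply: (derive1_open_cst _ `]-oo, c[%classic 0) => //; last by rewrite inE/= in_itv.
  by move=> x /[!inE]/=; rewrite in_itv/= => xc; exact/step_at_le/ltW.
- apply: (derive1_open_cst _ `]c + e, +oo[%classic 1) => //.
    by move=> x /[!inE]/=; rewrite in_itv/= andbT => xc; exact/step_at_ge/ltW.
  by rewrite inE/= in_itv/= andbT.
Qed.

Lemma is_derive_step_at (t : R) :
  is_derive t 1 (step_at c e) ((step_at c e)^`()%classic t).
Proof. by have [+ _] := smooth_derive1 _ (smooth_step_at c e); exact. Qed.

Lemma continuous_derive_step_at : continuous (step_at c e)^`()%classic.
Proof.
by apply: smooth_continuous; have [_] := smooth_derive1 _ (smooth_step_at c e).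
Qed.

(** The derivative of the step is a probability density carried by [c, c + e]: it is nonnegative,
    vanishes outside the window, and its mass is the total rise 1. The integral is therefore an
    average of [F] over the window. *)
Lemma step_at_average (F : R -> R) (u v l eta : R) : u < c -> c + e < v ->
  {within `[u, v], continuous F} ->
  (forall t, c <= t <= c + e -> `|F t - l| <= eta) ->
  `|\int[mu]_(t in `[u, v]) (F t * (step_at c e)^`()%classic t) - l| <= eta.
Proof.
move=> uc cev cF Fl.
have uv : u < v by rewrite (lt_trans uc)// (le_lt_trans _ cev)// lerDl ltW.
set p := (step_at c e)^`()%classic.
have mE : measurable `[u, v] by exact: measurable_itv.
have cp : {within `[u, v], continuous p}.
  exact/continuous_subspaceT/continuous_derive_step_at.
have ci (g : R -> R) : {within `[u, v], continuous g} ->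
    mu.-integrable `[u, v] (EFin \o g).
  by move=> cg; apply: continuous_compact_integrable => //; exact: segment_compact.
have int1 : \int[mu]_(t in `[u, v]) p t = 1.
  rewrite /Rintegral (@continuous_FTC2 R p (step_at c e) u v)//.
  - by rewrite -EFinB/= step_at_ge ?(ltW cev)// step_at_le ?(ltW uc)// subr0.
  - have cs := smooth_continuous _ (smooth_step_at c e).
    split; first by move=> x _; have := is_derive_step_at x.
      by apply: cvg_at_right_filter; exact: cs.
    by apply: cvg_at_left_filter; exact: cs.
have intl : \int[mu]_(t in `[u, v]) (l * p t) = l.
  by rewrite RintegralZl ?int1 ?mulr1//; exact: ci.
rewrite -[X in _ - X]intl -RintegralB//; last 2 first.
  by apply: ci; exact: within_continuousM.
  by apply: ci; apply: within_continuousM => //; exact: within_continuous_cst.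
under eq_Rintegral do rewrite -mulrBl.
have cFp : {within `[u, v], continuous (fun t => (F t - l) * p t)}.
  apply: within_continuousM => //.
  by apply: within_continuousB => //; exact: within_continuous_cst.
apply: (le_trans (le_normr_Rintegral _ _)) => //; first exact: ci.
have -> : eta = \int[mu]_(t in `[u, v]) (eta * p t).
  by rewrite RintegralZl ?int1 ?mulr1//; exact: ci.
apply: le_Rintegral => //.
- by apply: ci; exact: within_continuous_norm.
- by apply: ci; apply: within_continuousM => //; exact: within_continuous_cst.
- move=> x _; rewrite normrM (ger0_norm (step_at_derive_ge0 _)).
  have [xc|cx] := ltP x c.
    by rewrite /p step_at_derive_out ?mulr0//; left.
  have [xc|xc] := ltP (c + e) x.
    by rewrite /p step_at_derive_out ?mulr0//; right.
  by rewrite ler_wpM2r ?step_at_derive_ge0// Fl// cx xc.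
Qed.

End step_at.

Lemma Rintegral_support {R : realType} (A D : set R) (f : R -> R) :
  A `<=` D -> (forall x, D x -> ~ A x -> f x = 0) ->
  \int[@lebesgue_measure R]_(x in D) f x = \int[@lebesgue_measure R]_(x in A) f x.
Proof.
move=> AD f0; rewrite Rintegral_mkcond [RHS]Rintegral_mkcond.
congr Rintegral; apply/funext => x; rewrite /patch.
case: ifPn => [|/negP] /[!inE] xD; case: ifPn => [|/negP] /[!inE] xA //.
- exact: f0.
- by exfalso; apply: xD; exact: AD.
Qed.

(** * Oscillation of the derivative *)

Local Opaque step_at.

(** Used to pass from the averages [a] and [b] of y' over two short windows to its point values [a']
    and [b']. *)
Lemma le_dist_perturb {R : realType} (a b a' b' eta : R) (z : \bar R) :
  (`|b - a|%:E <= z)%E -> `|b - b'| <= eta -> `|a - a'| <= eta ->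
  (`|b' - a'|%:E <= z + (eta *+ 2)%:E)%E.
Proof.
move=> baz hb ha; apply: le_trans (leeD baz (lexx _)).
rewrite -EFinD lee_fin.
have -> : b' - a' = (b - a) + - (b - b') + (a - a') by ring.
apply: (le_trans (ler_normD _ _)); rewrite mulr2n addrA lerD//.
by apply: (le_trans (ler_normD _ _)); rewrite normrN lerD.
Qed.

Section weak_second_derivative.
Context {R : realType}.
Notation mu := (@lebesgue_measure R).
Variables (T : R) (y g : R -> R).
Let D : set R := `]0, T[.
Hypothesis wg : is_weak_derivative D 2 y g.
Hypothesis dy : forall t, t \in `]0, T[ -> derivable y t 1.
Hypothesis cdy : forall t, t \in `]0, T[ -> {for t, continuous y^`()%classic}.

Section bump.
Variables (r s e : R).
Hypotheses (e0 : 0 < e) (rs : r < s) (re : 0 < r - e *+ 2) (se : s + e *+ 2 < T).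
(** The bump lives on [r - e, s + e]. The wider interval [u, v] leaves room at both ends, where all
    derivatives of the bump vanish and no boundary term survives. *)
Let u := r - e *+ 2.
Let v := s + e *+ 2.
(* phi' is a unit mass left of r minus a unit mass right of s, so the integral of
   y * phi'' is y' s - y' r up to the oscillation of y' over the two windows. *)
Let phi t := step_at (r - e) e t - step_at s e t.
Let p1 := (step_at (r - e) e)^`()%classic.
Let p2 := (step_at s e)^`()%classic.

Let e20 : e < e *+ 2. Proof. by rewrite mulr2n ltrDl. Qed.
Let ur : u < r - e. Proof. by rewrite /u ltrD2l ltrN2. Qed.
Let sv : s + e < v. Proof. by rewrite /v ltrD2l. Qed.
Let re_r : r - e < r. Proof. by rewrite gtrDl oppr_lt0. Qed.
Let s_se : s < s + e. Proof. by rewrite ltrDl. Qed.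
Let re_se : r - e < s + e.
Proof. by rewrite (lt_trans re_r)// (lt_trans rs). Qed.
Let uv : u < v. Proof. by rewrite (lt_trans ur)// (lt_trans re_se). Qed.
Let uvD : `[u, v] `<=` D.
Proof.
rewrite /D => x /=; rewrite !in_itv/= => /andP[ux xv].
by rewrite (lt_le_trans re ux) (le_lt_trans xv se).
Qed.
Let KD : `[r - e, s + e] `<=` D.
Proof.
move=> x; rewrite /= in_itv/= => /andP[rx xs]; apply: uvD; rewrite /= in_itv/=.
by rewrite (le_trans (ltW ur))//= (le_trans _ (ltW sv)).
Qed.

Let smooth_phi : smooth phi.
Proof.
move=> n; have -> : phi = (fun t => step_at (r - e) e t + (-1 * step_at s e t + 0)).
  by apply/funext => t; rewrite addr0 mulN1r.
apply: ndiffD; first exact: smooth_step_at.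
exact: (ndiff_comp _ _ _ (smooth_affine _ _ n) (smooth_step_at s e n)).
Qed.

Let phi_lt t : t <= r - e -> phi t = 0.
Proof.
move=> tr; rewrite /phi !step_at_le ?subrr//.
by rewrite (le_trans tr)// ltW// (lt_trans re_r).
Qed.

Let phi_gt t : s + e <= t -> phi t = 0.
Proof.
move=> st; rewrite /phi !step_at_ge ?subrr// subrK.
by rewrite (le_trans _ st)// ltW// (lt_trans rs).
Qed.

Let phi_le1 t : `|phi t| <= 1.
Proof.
have := step_at_ge0 (r - e) e e0 t; have := step_at_le1 (r - e) e e0 t.
have := step_at_ge0 s e e0 t; have := step_at_le1 s e e0 t.
rewrite /phi; move: (step_at _ _ _) (step_at _ _ _) => p q.
by rewrite ler_norml; lra.
Qed.

Let test_phi : test_function D phi.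
Proof.
split; first by move=> k x; exact: smooth_derivable.
exists `[r - e, s + e]%classic; split => //; first exact: segment_compact.
move=> x; rewrite /= in_itv/= => /negP; rewrite negb_and -!ltNge => /orP[] /ltW.
  exact: phi_lt.
exact: phi_gt.
Qed.

Let derive_phi : phi^`()%classic = (fun t => p1 t - p2 t).
Proof.
apply/funext => t; have d1 := is_derive_step_at (r - e) e t.
have d2 := is_derive_step_at s e t.
by rewrite derive1E; exact: (@derive_val _ _ _ _ _ _ _ (is_deriveB d1 d2)).
Qed.

Let p1_out t : t < r - e \/ r < t -> p1 t = 0.
Proof. by move=> ht; rewrite /p1 step_at_derive_out// subrK. Qed.

Let p2_out t : t < s \/ s + e < t -> p2 t = 0.
Proof. by move=> ht; rewrite /p2 step_at_derive_out. Qed.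

Let dphi_lt t : t < r - e -> phi^`()%classic t = 0.
Proof.
move=> tr; have ts : t < s by rewrite (lt_trans tr)// (lt_trans re_r).
by rewrite derive_phi (p1_out _ (or_introl tr)) (p2_out _ (or_introl ts)) subrr.
Qed.

Let dphi_gt t : s + e < t -> phi^`()%classic t = 0.
Proof.
move=> st; have rt : r < t by rewrite (lt_trans rs)// (lt_trans s_se).
by rewrite derive_phi (p1_out _ (or_intror rt)) (p2_out _ (or_intror st)) subrr.
Qed.

Let ddphi_out t : ~ `[u, v]%classic t -> phi^`(2)%classic t = 0.
Proof.
rewrite derive1nS derive1n1 /= in_itv/= => /negP; rewrite negb_and -!ltNge => /orP[] tx.
- apply: (derive1_open_cst _ `]-oo, r - e[%classic 0) => //.
    by move=> x /[!inE]/=; rewrite in_itv/=; exact: dphi_lt.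
  by rewrite inE/= in_itv/= (lt_trans tx).
- apply: (derive1_open_cst _ `]s + e, +oo[%classic 0) => //.
    by move=> x /[!inE]/=; rewrite in_itv/= andbT; exact: dphi_gt.
  by rewrite inE/= in_itv/= andbT (lt_trans _ tx).
Qed.

Let cy : {within `[u, v], continuous y}.
Proof.
apply: continuous_in_subspaceT => x; rewrite inE => /uvD xD.
by apply: differentiable_continuous; apply/derivable1_diffP; exact: dy.
Qed.

Let cy' : {within `[u, v], continuous y^`()%classic}.
Proof. by apply: continuous_in_subspaceT => x; rewrite inE => /uvD xD; exact: cdy. Qed.

(** One integration by parts on [u, v]. The second derivative of y exists only weakly, so a single
    derivative is moved onto y, and the remaining factor [p1 - p2] averages y' near r and near s. *)
Lemma integral_phi2 : \int[mu]_(t in D) (y t * phi^`(2)%classic t) =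
  \int[mu]_(t in `[u, v]) (y^`()%classic t * p2 t) -
  \int[mu]_(t in `[u, v]) (y^`()%classic t * p1 t).
Proof.
have [dphi sdphi] := smooth_derive1 _ smooth_phi.
have [ddphi sddphi] := smooth_derive1 _ sdphi.
rewrite (Rintegral_support `[u, v]%classic)//; last first.
  by move=> x _ /ddphi_out ->; rewrite mulr0.
have LR (F : R -> R) : (forall x, x \in `[u, v] -> derivable F x 1) ->
    derivable_oo_LRcontinuous F u v.
  move=> dF; have cF x : x \in `[u, v] -> {for x, continuous F}.
    move=> /dF ?; apply: differentiable_continuous.
    exact/derivable1_diffP.
  split.
  - by move=> x xuv; apply: dF; exact: subset_itv_oo_cc.
  - by apply: cvg_at_right_filter; apply: cF; rewrite in_itv/= lexx ltW.
  - by apply: cvg_at_left_filter; apply: cF; rewrite in_itv/= lexx ltW.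
have cddphi : {within `[u, v], continuous phi^`(2)%classic}.
  by apply: continuous_subspaceT; exact: smooth_continuous.
have LRy : derivable_oo_LRcontinuous y u v.
  by apply: LR => x xuv; apply: dy; exact: uvD.
have LRphi : derivable_oo_LRcontinuous phi^`()%classic u v.
  by apply: LR => x xuv; have [] := ddphi x.
rewrite (@Rintegration_by_parts R y phi^`()%classic y^`()%classic phi^`(2)%classic u v uv cy' LRy
  (fun _ _ => erefl) cddphi LRphi (fun _ _ => erefl)).
rewrite (dphi_gt _ sv) (dphi_lt _ ur) !mulr0 subrr sub0r derive_phi.
have ci (h : R -> R) : {within `[u, v], continuous h} ->
    mu.-integrable `[u, v] (EFin \o h).
  by move=> ch; apply: continuous_compact_integrable => //; exact: segment_compact.
under eq_Rintegral do rewrite mulrBr.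
rewrite RintegralB ?opprB//; apply: ci; apply: within_continuousM => //.
  exact/continuous_subspaceT/continuous_derive_step_at.
exact/continuous_subspaceT/continuous_derive_step_at.
Qed.

(** Holds because |[phi]| <= 1 and [phi] vanishes off [r - e, s + e], a compact subset of [D] on
    which [g] is integrable. *)
Lemma le_integral_phi :
  (`|\int[mu]_(t in D) (g t * phi t)|%:E <= \int[mu]_(t in `[(r - e)%R, (s + e)%R]) `|g t|%:E)%E.
Proof.
rewrite (Rintegral_support `[r - e, s + e]%classic)//; last first.
  move=> x _; rewrite /= in_itv/= => /negP; rewrite negb_and -!ltNge => /orP[] /ltW.
    by move=> /phi_lt ->; rewrite mulr0.
  by move=> /phi_gt ->; rewrite mulr0.
have [_ [mg oD gfin] _] := wg.
have mK : measurable `[r - e, s + e]%classic by exact: measurable_itv.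
have mgK : measurable_fun `[r - e, s + e] g.
  by apply: measurable_funS mg => //; exact: measurable_itv.
have mphi : measurable_fun `[r - e, s + e] phi.
  apply: measurable_funTS; apply: continuous_measurable_fun.
  exact: smooth_continuous.
have mgphi : measurable_fun `[r - e, s + e] (fun t => g t * phi t).
  exact: measurable_funM.
have le1 t : `|g t * phi t| <= `|g t| by rewrite normrM ler_piMr.
have ig : mu.-integrable `[r - e, s + e] (EFin \o g).
  apply/integrableP; split; first exact/measurable_EFinP.
  by apply: gfin => //; exact: segment_compact.
have igp : mu.-integrable `[r - e, s + e] (EFin \o (fun t => g t * phi t)).
  apply: le_integrable ig => //; first exact/measurable_EFinP.
  by move=> t _ /=; rewrite lee_fin.
rewrite EFin_normr_Rintegral//; apply: le_trans.
  by apply: le_abse_integral => //; exact/measurable_EFinP.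
apply: ge0_le_integral => //=.
- by apply/measurable_EFinP; exact: measurableT_comp.
- by apply/measurable_EFinP; exact: measurableT_comp.
- by move=> t _; rewrite lee_fin.
Qed.

(** The identity defining the weak derivative equates the integral of [g * phi] with a difference of
    two averages of y'; each average is within [eta] of the corresponding point value. *)
Lemma weak_osc_bump eta :
  (forall t, r - e <= t <= r -> `|y^`()%classic t - y^`()%classic r| <= eta) ->
  (forall t, s <= t <= s + e -> `|y^`()%classic t - y^`()%classic s| <= eta) ->
  (`|y^`()%classic s - y^`()%classic r|%:E <=
   \int[mu]_(t in `[(r - e)%R, (s + e)%R]) `|g t|%:E + (eta *+ 2)%:E)%E.
Proof.
move=> h1 h2; have [_ _ /(_ _ test_phi)] := wg.
rewrite integral_phi2 expr2 mulrN1 opprK mul1r => eqw.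
have rv : r < v by rewrite (lt_trans rs)// (lt_trans s_se).
have us : u < s by rewrite (lt_trans ur)// (lt_trans re_r).
have H1 := @step_at_average R (r - e) e e0 y^`()%classic u v (y^`()%classic r) eta ur.
rewrite subrK in H1; have := le_integral_phi; rewrite -eqw => /le_dist_perturb; apply.
  exact: (@step_at_average R s e e0 y^`()%classic u v (y^`()%classic s) eta us sv cy' h2).
exact: H1 rv cy' h1.
Qed.

End bump.

(** Let the windows shrink: continuity of y' at r and s makes both errors at most eps / 2, and the
    enlarged interval [r - e, s + e] still lies in the open interval ]a, b[. *)
Lemma weak_derivative2_osc (a b r s : R) : 0 <= a -> b <= T ->
  r \in `]a, b[ -> s \in `]a, b[ ->
  (`|y^`()%classic s - y^`()%classic r|%:E <= \int[mu]_(t in `]a, b[) `|g t|%:E)%E.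
Proof.
move=> a0 bT; wlog rs : r s / r < s => [hw rI sI|].
  have [rs|sr|->] := ltgtP r s; first exact: hw.
    by rewrite distrC; exact: hw.
  by rewrite subrr normr0; apply: integral_ge0.
rewrite !in_itv/= => /andP[ar _] /andP[_ sb].
apply/lee_addgt0Pr => eps eps0.
have near_osc x : 0 < x -> x < T ->
    \forall d \near (0:R)^'+, forall t, `|t - x| <= d ->
      `|y^`()%classic t - y^`()%classic x| <= eps / 2.
  move=> x0 xT; have xD : x \in `]0, T[ by rewrite in_itv/= x0.
  have /cvgrPdist_le/(_ (eps / 2)) := cdy _ xD.
  rewrite divr_gt0// => /(_ isT); rewrite -nbhs_nearE => /nbhs_ballP[d /= d0 hd].
  near=> d' => t td; rewrite distrC; apply: hd; rewrite /ball/= distrC.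
  by apply: (le_lt_trans td); near: d'; exact: nbhs_right_lt.
have r0 : 0 < r by exact: le_lt_trans ar.
have sT : s < T by exact: lt_le_trans bT.
have near_small k : 0 < k -> \forall d \near (0:R)^'+, d *+ 2 < k.
  move=> k0; near=> d; rewrite -mulr_natr -ltr_pdivlMr//.
  by near: d; apply: nbhs_right_lt; rewrite divr_gt0.
near (0:R)^'+ => e.
have e0 : 0 < e by near: e; exact: nbhs_right_gt.
have rae : e *+ 2 < r - a by near: e; apply: near_small; rewrite subr_gt0.
have sbe : e *+ 2 < b - s by near: e; apply: near_small; rewrite subr_gt0.
have re : a < r - e *+ 2 by rewrite ltrBrDl -ltrBrDr.
have se : s + e *+ 2 < b by rewrite -ltrBrDl.
have are : a < r - e by rewrite mulr2n in re; lra.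
have seb : s + e < b by rewrite mulr2n in se; lra.
apply: (le_trans (weak_osc_bump r s e e0 rs _ _ (eps / 2) _ _)).
- exact: le_lt_trans re.
- exact: lt_le_trans bT.
- have : forall t, `|t - r| <= e -> `|y^`()%classic t - y^`()%classic r| <= eps / 2.
    by near: e; apply: near_osc => //; exact: lt_trans sT.
  by move=> h t ?; apply: h; rewrite ler_norml; lra.
- have : forall t, `|t - s| <= e -> `|y^`()%classic t - y^`()%classic s| <= eps / 2.
    by near: e; apply: near_osc => //; exact: lt_trans rs.
  by move=> h t ?; apply: h; rewrite ler_norml; lra.
rewrite -[_ *+ 2]mulr_natr divfK// leeD2r//.
have [_ [mg _ _] _] := wg.
apply: ge0_subset_integral => //.
- apply/measurable_EFinP; apply: measurableT_comp => //.
  apply: measurable_funS mg; first exact: measurable_itv.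
  move=> t; rewrite /D /= !in_itv/= => /andP[at_ tb].
  by rewrite (le_lt_trans a0 at_)/= (lt_le_trans tb bT).
- move=> t; rewrite /= !in_itv/= => /andP[rt ts].
  by rewrite (lt_le_trans are rt)/= (le_lt_trans ts seb).
Unshelve. all: by end_near. Qed.

End weak_second_derivative.

(** * Singular integrals and the Gamma function *)

Section singular_integrals.
Context {R : realType}.
Notation mu := (@lebesgue_measure R).

(** The integrand may blow up at the end points, as the kernel does. The usual theorem applies on
    the segments [A n] that exhaust ]a, b[; nonnegativity gives monotone convergence of the
    integrals, continuity of [F] up to the end points gives the limit of the increments. *)
Lemma ge0_continuous_FTC2oo (f F : R -> R) (a b : R) : a < b ->
  (forall t, t \in `]a, b[ -> 0 <= f t) ->
  (forall t, t \in `]a, b[ -> {for t, continuous f}) ->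
  (forall t, t \in `]a, b[ -> is_derive t 1 F (f t)) ->
  {within `[a, b], continuous F} ->
  (\int[mu]_(t in `]a, b[) (f t)%:E = (F b - F a)%:E)%E.
Proof.
move=> ab f0 cf dF cF.
have ba0 : 0 < (b - a) / 3 by rewrite divr_gt0// subr_gt0.
(* A third of the length keeps [a + d n < b - d n] for every [n]. *)
pose d n : R := (b - a) / 3 * harmonic n.
have d0 n : 0 < d n by rewrite /d mulr_gt0// harmonic_gt0.
have dle n : d n <= (b - a) / 3.
  rewrite /d ler_piMr ?(ltW ba0)//.
  by rewrite invf_le1 ?ler1n ?ltr0n.
have dcvg : d n @[n --> \oo] --> (0 : R).
  rewrite -[X in _ --> X](mulr0 ((b - a) / 3)); apply: cvgMr; exact: cvg_harmonic.
have dnincr m n : (m <= n)%N -> d n <= d m.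
  by move=> mn; rewrite /d ler_wpM2l ?(ltW ba0)// lef_pV2 ?ler_nat ?posrE ?ltr0n.
pose A n := `[a + d n, b - d n]%classic.
have AS n : A n `<=` `]a, b[.
  move=> t; rewrite /A /= !in_itv/= => /andP[h1 h2].
  by rewrite (lt_le_trans _ h1) ?ltrDl//= (le_lt_trans h2)// gtrDl oppr_lt0.
have Anlt n : a + d n < b - d n.
  by have := dle n; lra.
have intA n : (\int[mu]_(t in A n) (f t)%:E = (F (b - d n) - F (a + d n))%:E)%E.
  have inA t : t \in `[a + d n, b - d n] -> t \in `]a, b[ by exact: AS.
  have cFt t : t \in `]a, b[ -> {for t, continuous F}.
    move=> /dF dFt; apply: differentiable_continuous.
    by apply/derivable1_diffP; case: dFt.
  have cFA : forall t, t \in `[a + d n, b - d n] -> {for t, continuous F}.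
    by move=> t /inA; exact: cFt.
  rewrite (@continuous_FTC2 R f F)// ?EFinB//.
  - by apply: continuous_in_subspaceT => t; rewrite inE => /inA; exact: cf.
  - split.
    + by move=> t /subset_itv_oo_cc/inA/dF [].
    + by apply: cvg_at_right_filter; apply: cFA; rewrite in_itv/= lexx ltW.
    + by apply: cvg_at_left_filter; apply: cFA; rewrite in_itv/= lexx ltW.
  - move=> t /subset_itv_oo_cc/inA/dF [_ <-]; exact: derive1E.
have UA : \bigcup_n A n = `]a, b[%classic.
  apply/seteqP; split; first by move=> t [n _]; exact: AS.
  move=> t; rewrite /= in_itv/= => /andP[at_ tb].
  have [n hn] : exists n, d n <= Num.min (t - a) (b - t).
    have m0 : 0 < Num.min (t - a) (b - t) by rewrite lt_min !subr_gt0 at_.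
    have /cvgrPdist_le/(_ _ m0)[n _ /(_ n (leqnn _))] := dcvg.
    by rewrite sub0r normrN gtr0_norm//; exists n.
  exists n => //; rewrite /A /= in_itv/=; move: hn; rewrite le_min => /andP[].
  by lra.
rewrite -UA; apply: (@cvg_unique _ (@ereal_hausdorff R)
  ((\int[mu]_(t in A n) (f t)%:E)%E @[n --> \oo])).
  apply: ge0_nondecreasing_set_cvg_integral.
  - move=> m n mn; apply/subsetPset => t; rewrite /A /= !in_itv/=.
    by have := dnincr _ _ mn; lra.
  - by move=> n; exact: measurable_itv.
  - move=> n; apply/measurable_EFinP; apply: (@measurable_funS _ _ _ _ `]a, b[%classic) => //.
    by apply: open_continuous_measurable_fun => // t; rewrite inE; exact: cf.
  - by move=> n t /AS tab; rewrite lee_fin f0.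
rewrite /= (funext intA).
have [_ Fa Fb] := (continuous_within_itvP F ab).1 cF.
apply: cvg_EFin; first exact: nearW.
apply: cvgB.
- apply: (cvg_at_leftP _ _ _).1 Fb _ _; split; first by move=> n; rewrite gtrDl oppr_lt0.
  by rewrite -[X in _ --> X]subr0; apply: cvgB => //; exact: cvg_cst.
- apply: (cvg_at_rightP _ _ _).1 Fa _ _; split; first by move=> n; rewrite ltrDl.
  by rewrite -[X in _ --> X]addr0; apply: cvgD => //; exact: cvg_cst.
Qed.

Lemma is_derive_powR_sub (b x t : R) : t < b ->
  is_derive t 1 (fun s => (b - s) `^ x) (- (x * (b - t) `^ (x - 1))).
Proof.
move=> tb; have dsub : is_derive t (1:R) (fun s : R => b - s) (-1).
  by rewrite -[X in is_derive _ _ _ X]sub0r; exact: is_deriveB.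
have bt0 : 0 < b - t by rewrite subr_gt0.
by have := @is_derive1_comp _ (@powR R ^~ x) (fun s => b - s) _ _ _ (is_derive1_powR x bt0) dsub;
  rewrite mulrN1.
Qed.

Lemma continuous_powR_sub (b x t : R) : t < b ->
  {for t, continuous (fun s => (b - s) `^ x)}.
Proof.
move=> /(is_derive_powR_sub b x) d; apply: differentiable_continuous.
by apply/derivable1_diffP; case: d.
Qed.

Lemma cvg_powR_sub_left (b x : R) : 0 < x -> (b - t) `^ x @[t --> b^'-] --> (0 : R).
Proof.
move=> x0; apply/cvg_at_leftP => u [ub cu].
have /cvg_at_rightP/(_ (fun n => b - u n)) := powR_cvg0 x0; apply; split.
  by move=> n; rewrite subr_gt0.
by rewrite -[X in _ --> X](subrr b); apply: cvgB => //; exact: cvg_cst.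
Qed.

(** The case b = c is the singular one: for x < 1 the integrand is unbounded near b, but the
    primitive -(c - t)^x / x stays continuous there because x > 0. *)
Lemma integral_powR_sub (a b c x : R) : a < b -> b <= c -> 0 < x ->
  (\int[mu]_(t in `]a, b[) ((c - t) `^ (x - 1))%:E =
   (((c - a) `^ x - (c - b) `^ x) / x)%:E)%E.
Proof.
move=> ab bc x0.
pose F t : R := (c - t) `^ x * - x^-1.
have -> : ((c - a) `^ x - (c - b) `^ x) / x = F b - F a.
  by rewrite /F !mulrN opprK mulrBl addrC.
have cF t : t < c -> {for t, continuous F}.
  by move=> tb; apply: cvgM; [exact: continuous_powR_sub|exact: cvg_cst].
apply: ge0_continuous_FTC2oo => //.
- by move=> t _; exact: powR_ge0.
- move=> t; rewrite in_itv/= => /andP[_ tb].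
  by apply: continuous_powR_sub; exact: lt_le_trans bc.
- move=> t; rewrite in_itv/= => /andP[_ tb].
  have tc : t < c by exact: lt_le_trans bc.
  have := is_deriveM (is_derive_powR_sub c x t tc) (is_derive_cst (- x^-1) t (1:R)).
  rewrite scaler0 add0r.
  have sE (u v : R) : u *: (v : R^o) = u * v by []; rewrite sE.
  by rewrite /= mulrNN mulKf// gt_eqF.
- apply/continuous_within_itvP => //; split.
  + by move=> t; rewrite in_itv/= => /andP[_ tb]; apply: cF; exact: lt_le_trans bc.
  + by apply: cvg_at_right_filter; apply: cF; exact: lt_le_trans bc.
  + move: bc; rewrite le_eqVlt => /predU1P[bc|bc]; last first.
      by apply: cvg_at_left_filter; exact: cF.
    apply: cvgM; last exact: cvg_cst.
    by rewrite bc subrr powR0 ?gt_eqF//; exact: cvg_powR_sub_left.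
Qed.

End singular_integrals.

Lemma continuous_powRl {R : realType} (x t : R) : 0 < t ->
  {for t, continuous (@powR R ^~ x)}.
Proof.
move=> /(is_derive1_powR x) d; apply: differentiable_continuous.
by apply/derivable1_diffP; case: d.
Qed.

Section gamma.
Context {R : realType}.
Notation mu := (@lebesgue_measure R).

Let g (x t : R) : R := t `^ (x - 1) * expR (- t).
(** [Gamma] is the [fine] part of this integral, so positivity and the functional equation are
    settled in the extended reals first, where the limits always make sense. *)
Let I (x : R) : \bar R := (\int[mu]_(t in `]0%R, +oo[) (g x t)%:E)%E.

Let g_ge0 x t : 0 <= g x t.
Proof. by rewrite mulr_ge0 ?powR_ge0 ?expR_ge0. Qed.

Let continuous_g x t : 0 < t -> {for t, continuous (g x)}.
Proof.
move=> t0; apply: (@continuousM _ _ (@powR R ^~ (x - 1)) (fun t => expR (- t))).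
  exact: continuous_powRl.
by apply: continuous_comp; [exact: opp_continuous|exact: continuous_expR].
Qed.

Let measurable_g x : measurable_fun (`]0, +oo[ : set R) (g x).
Proof.
apply: open_continuous_measurable_fun => // t; rewrite inE/= in_itv/= andbT.
exact: continuous_g.
Qed.

(** The shift by 2 gives [a n < 1 < b n] already for n = 0, so no segment is degenerate. *)
Let a n : R := n.+2%:R^-1.
Let b n : R := n.+2%:R.
Let a0 n : 0 < a n. Proof. by rewrite invr_gt0 ltr0n. Qed.
Let ab n : a n < b n.
Proof. by rewrite (@lt_trans _ _ 1)// ?invf_lt1 ?ltr0n ?ltr1n. Qed.
Let A n : set R := `[a n, b n].

Let A_sub n : A n `<=` `]0, +oo[.
Proof. by move=> t; rewrite /A /= !in_itv/= andbT => /andP[/(lt_le_trans (a0 n))]. Qed.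

Let j x n : R := \int[mu]_(t in A n) g x t.

Let integrable_g x n : mu.-integrable (A n) (EFin \o g x).
Proof.
apply: continuous_compact_integrable; first exact: segment_compact.
apply: continuous_in_subspaceT => t; rewrite inE => /A_sub /=.
by rewrite in_itv/= andbT; exact: continuous_g.
Qed.

Let A_bigcup : \bigcup_n A n = `]0, +oo[%classic.
Proof.
apply/seteqP; split; first by move=> t [n _]; exact: A_sub.
move=> t; rewrite /= in_itv/= andbT => t0.
have [n hn] : exists n, Num.max t t^-1 <= b n.
  exists (Num.truncn (Num.max t t^-1)); apply: (@le_trans _ _ (Num.truncn (Num.max t t^-1)).+1%:R).
    by apply/ltW/truncnS_gt.
  by rewrite /b ler_nat.
exists n => //; move: hn; rewrite ge_max => /andP[tb tVb].
by rewrite /A /= in_itv/= tb andbT /a -[t]invrK lef_pV2 ?posrE ?invr_gt0.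
Qed.

Let cvg_j x : (j x n)%:E @[n --> \oo] --> I x.
Proof.
have -> : (fun n => (j x n)%:E) = (fun n => \int[mu]_(t in A n) (g x t)%:E)%E.
  by apply/funext => n; rewrite /j /Rintegral fineK//;
    by apply: integrable_fin_num; [exact: measurable_itv|exact: integrable_g].
rewrite /I -A_bigcup; apply: ge0_nondecreasing_set_cvg_integral.
- move=> m n mn; apply/subsetPset => t; rewrite /A /= !in_itv/= => /andP[mt tm].
  apply/andP; split.
    by apply: le_trans mt; rewrite /a lef_pV2 ?posrE ?ltr0n// ler_nat !ltnS.
  by apply: (le_trans tm); rewrite ler_nat !ltnS.
- by move=> n; exact: measurable_itv.
- move=> n; apply/measurable_EFinP.
  exact: measurable_funS (@A_sub n) (measurable_g x).
- by move=> n t _; rewrite lee_fin.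
Qed.

(** Integrate by parts on the segments [A n]: the boundary terms [c n] tend to 0 and both integrals
    converge monotonically. The passage to the limit does not presuppose that the integrals are
    finite. *)
Lemma Gamma_integral_succ (x : R) : 0 < x <= 1 -> I (x + 1) = (x%:E * I x)%E.
Proof.
move=> /andP[x0 x1].
pose c n : R := a n `^ x * expR (- a n) - b n `^ x * expR (- b n).
have jS n : j (x + 1) n = c n + x * j x n.
  have dpow (t : R) : 0 < t -> is_derive t 1 (@powR R ^~ x) (x * t `^ (x - 1)).
    by move=> t0; exact: is_derive1_powR.
  have dexp (t : R) : is_derive t 1 (fun t : R => - expR (- t)) (expR (- t)).
    have dN : is_derive t (1 : R) (fun t : R => - t) (-1) by exact: is_deriveN.
    rewrite -[X in is_derive _ _ _ X]opprK -[X in - X]mulrN1.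
    exact: (is_deriveN (is_derive1_comp (is_derive_expR (- t)) dN)).
  have LR (F f : R -> R) : (forall t : R, 0 < t -> is_derive t 1 F (f t)) ->
      derivable_oo_LRcontinuous F (a n) (b n) /\ {in `]a n, b n[, F^`()%classic =1 f}.
    move=> dF; have cF t : 0 < t -> {for t, continuous F}.
      move=> /dF d; apply: differentiable_continuous.
      by apply/derivable1_diffP; case: d.
    have t0 t : t \in `]a n, b n[ -> 0 < t.
      by rewrite in_itv/= => /andP[+ _]; exact: lt_trans.
    split; first split.
    - by move=> t /t0/dF [].
    - by apply: cvg_at_right_filter; exact: cF.
    - by apply: cvg_at_left_filter; apply: cF; exact: lt_trans (ab n).
    - by move=> t /t0/dF [_ <-]; exact: derive1E.
  have [LRp dp] := LR _ _ dpow; have [LRe de] := LR _ _ (fun t _ => dexp t).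
  have cpos (f : R -> R) : (forall t, 0 < t -> {for t, continuous f}) ->
      {within `[a n, b n], continuous f}.
    move=> cf; apply: continuous_in_subspaceT => t; rewrite inE => /A_sub/=.
    by rewrite in_itv/= andbT; exact: cf.
  have cpow : {within `[a n, b n], continuous (fun t => x * t `^ (x - 1))}.
    apply: cpos => t t0; apply: cvgMr.
    exact: continuous_powRl.
  have cexp : {within `[a n, b n], continuous (fun t : R => expR (- t))}.
    apply: cpos => t t0.
    by apply: continuous_comp; [exact: opp_continuous|exact: continuous_expR].
  have := @Rintegration_by_parts R _ _ _ _ _ _ (ab n) cpow LRp dp cexp LRe de.
  rewrite /j /g addrK => ->.
  rewrite !mulrN opprK addrC (addrC (- _)) /c; congr (_ + _); first exact: addrC.
  under eq_Rintegral do rewrite mulrN -mulrA -mulNr.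
  rewrite RintegralZl ?mulNr ?opprK//; exact: integrable_g.
have cvga : a n @[n --> \oo] --> (0 : R).
  by have := @cvg_harmonic R; rewrite -cvg_shiftS.
have cvgc : c n @[n --> \oo] --> (0 : R).
  rewrite -[X in _ --> X](subrr 0); apply: cvgB.
  - apply: (@squeeze_cvgr _ _ _ _ (fun=> 0) (fun n => a n `^ x)).
    + apply: nearW => n; rewrite mulr_ge0 ?powR_ge0 ?expR_ge0//=.
      rewrite ler_piMr ?powR_ge0// -expR0 ler_expR oppr_le0.
      exact: ltW.
    + exact: cvg_cst.
    + exact: ((cvg_at_rightP _ _ _).1 (powR_cvg0 x0) a (conj a0 cvga)).
  (* For b >= 1 and x <= 1, b^x exp(-b) <= b exp(-b) <= 4 / b, by [expr_le_expR] with exponent 2. *)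
  - apply: (@squeeze_cvgr _ _ _ _ (fun=> 0) (fun n => 2%:R ^+ 2 * a n)).
    + apply: nearW => n; rewrite mulr_ge0 ?powR_ge0 ?expR_ge0//=.
      have b1 : 1 <= b n by rewrite ler1n.
      have b0 : 0 < b n by exact: lt_le_trans b1.
      rewrite expRN ler_pdivrMr ?expR_gt0// mulrAC ler_pdivlMr//.
      apply: le_trans (expr_le_expR 2 (b n) (ltW b0)).
      by rewrite expr2 ler_wpM2r ?(ltW b0)// ler1_powR.
    + exact: cvg_cst.
    + by rewrite -[X in _ --> X](mulr0 (2%:R ^+ 2)); exact: cvgMr.
have cvgS : (j (x + 1) n)%:E @[n --> \oo] --> (x%:E * I x)%E.
  have -> : (fun n => (j (x + 1) n)%:E) = (fun n => (c n)%:E + x%:E * (j x n)%:E)%E.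
    by apply/funext => n; rewrite jS EFinD EFinM.
  rewrite -[X in _ --> X]add0e; apply: cvgeD => //.
  - by apply: cvg_EFin => //; exact: nearW.
  - by apply: cvgeZl => //; exact: cvg_j.
exact: (cvg_unique (@ereal_hausdorff R) (cvg_j (x + 1)) cvgS).
Qed.

(** On ]0, 1[ the integrand is at least exp(-1), because x <= 1. *)
Lemma Gamma_integral_gt0 (x : R) : 0 < x <= 1 -> (0 < I x)%E.
Proof.
move=> /andP[x0 x1]; apply: (@lt_le_trans _ _ (expR (-1))%:E).
  by rewrite lte_fin expR_gt0.
apply: (@le_trans _ _ (\int[mu]_(t in `]0%R, 1%R[) (g x t)%:E)%E).
  rewrite -[leLHS]mule1 -[X in (_ * X)%E](_ : mu `]0%R, 1%R[ = 1%E); last first.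
    by rewrite lebesgue_measure_itv/= lte_fin ltr01 oppr0 addr0.
  rewrite -integral_cst//; apply: ge0_le_integral => //=.
  - apply/measurable_EFinP; apply: measurable_funS (measurable_g x) => //.
    exact: subset_itvl.
  - move=> t /=; rewrite in_itv/= => /andP[t0 t1]; rewrite lee_fin /g.
    rewrite -[leLHS]mul1r ler_pM ?expR_ge0//.
      by rewrite -[leLHS](powRr0 t) ger_powR ?t0 ?(ltW t1)// subr_le0.
    by rewrite ler_expR lerN2 ltW.
apply: ge0_subset_integral => //.
- by apply/measurable_EFinP; exact: measurable_g.
- by move=> t _; rewrite lee_fin.
- exact: subset_itvl.
Qed.

(** Split at 1: the integrand is at most t^(x - 1) on the left, integrable since x > 0, and at most
    exp(-t) on the right, since x <= 1. *)
Lemma Gamma_integral_lty (x : R) : 0 < x <= 1 -> (I x < +oo)%E.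
Proof.
move=> /andP[x0 x1].
have eU : `]0, +oo[%classic = `]0, 1[ `|` `[1, +oo[ :> set R.
  by rewrite -(@itv_bndbnd_setU _ _ (BRight 0) (BLeft 1) +oo%O) ?bnd_simp.
have m01 : measurable_fun (`]0, 1[ : set R) (g x).
  by apply: measurable_funS (measurable_g x) => //; exact: subset_itvl.
have m1y : measurable_fun (`[1, +oo[ : set R) (g x).
  by apply: measurable_funS (measurable_g x) => //; rewrite eU; exact: subsetUr.
rewrite /I eU ge0_integral_setU//=; last 3 first.
  - by apply/measurable_EFinP; rewrite -eU; exact: measurable_g.
  - by move=> t _; rewrite lee_fin.
  - apply/disj_setPS => t /=; rewrite !in_itv/= andbT => -[/andP[_ t1]].
    by rewrite leNgt t1.
apply: lte_add_pinfty.
- apply: (@le_lt_trans _ _ (\int[mu]_(t in `]0%R, 1%R[) (t `^ (x - 1))%:E)%E).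
    apply: ge0_le_integral => //=.
    + by move=> t _; rewrite lee_fin.
    + exact/measurable_EFinP.
    + by apply/measurable_EFinP; apply: measurable_funTS; exact: measurable_powR.
    + move=> t /=; rewrite in_itv/= => /andP[t0 _]; rewrite lee_fin ler_piMr ?powR_ge0//.
      by rewrite -expR0 ler_expR oppr_le0 ltW.
  pose F t : R := t `^ x * x^-1.
  have -> : (\int[mu]_(t in `]0%R, 1%R[) (t `^ (x - 1))%:E = (F 1 - F 0)%:E)%E; last exact: ltry.
  apply: ge0_continuous_FTC2oo => //.
  + by move=> t _; exact: powR_ge0.
  + by move=> t; rewrite in_itv/= => /andP[t0 _]; exact: continuous_powRl.
  + move=> t; rewrite in_itv/= => /andP[t0 _].
    have := is_deriveM (is_derive1_powR x t0) (is_derive_cst x^-1 t (1:R)).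
    rewrite scaler0 add0r.
    have sE (u v : R) : u *: (v : R^o) = u * v by []; rewrite sE.
    by rewrite /= mulKf// gt_eqF.
  + apply/continuous_within_itvP => //; split.
    * move=> t; rewrite in_itv/= => /andP[t0 _].
      by apply: cvgM; [exact: continuous_powRl|exact: cvg_cst].
    * apply: cvgM; last exact: cvg_cst.
      by rewrite powR0 ?gt_eqF//; exact: powR_cvg0.
    * apply: cvg_at_left_filter.
      by apply: cvgM; [exact: continuous_powRl|exact: cvg_cst].
- apply: (@le_lt_trans _ _ (\int[mu]_(t in `[1%R, +oo[) (expR (- t))%:E)%E).
    apply: ge0_le_integral => //=.
    + by move=> t _; rewrite lee_fin.
    + exact/measurable_EFinP.
    + apply/measurable_EFinP; apply: measurable_funTS.
      apply: continuous_measurable_fun => t.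
      by apply: continuous_comp; [exact: opp_continuous|exact: continuous_expR].
    + move=> t /=; rewrite in_itv/= andbT => t1; rewrite lee_fin ler_piMl ?expR_ge0//.
      by rewrite -[leRHS](powRr0 t) ler_powR// subr_le0.
  have dexp (t : R) : is_derive t 1 (fun t : R => - expR (- t)) (expR (- t)).
    have dN : is_derive t (1 : R) (fun t : R => - t) (-1) by exact: is_deriveN.
    rewrite -[X in is_derive _ _ _ X]opprK -[X in - X]mulrN1.
    exact: (is_deriveN (is_derive1_comp (is_derive_expR (- t)) dN)).
  rewrite (@ge0_continuous_FTC2y _ _ (fun t => - expR (- t)) 1 0)//.
  + by rewrite -EFinB ltry.
  + apply: continuous_subspaceT => t.
    by apply: continuous_comp; [exact: opp_continuous|exact: continuous_expR].
  + by rewrite -oppr0; apply: cvgN; exact: cvgr_expR.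
  + apply: cvg_at_right_filter; apply: cvgN.
    by apply: continuous_comp; [exact: opp_continuous|exact: continuous_expR].
  + by move=> t _; rewrite derive1E; case: (dexp t).
Qed.

Lemma Gamma_gt0 (x : R) : 0 < x <= 1 -> 0 < Gamma x.
Proof.
by move=> x01; apply: fine_gt0; rewrite Gamma_integral_gt0// Gamma_integral_lty.
Qed.

Lemma GammaS (x : R) : 0 < x <= 1 -> Gamma (x + 1) = x * Gamma x.
Proof.
move=> x01; rewrite /Gamma /Rintegral [X in fine X](Gamma_integral_succ x x01).
rewrite fineM// fin_numElt Gamma_integral_lty// andbT.
by rewrite (lt_trans _ (Gamma_integral_gt0 x x01)).
Qed.

End gamma.

(** * Hoelder's inequality with the dual weight *)

Section weighted_hoelder.
Context {R : realType}.
Notation mu := (@lebesgue_measure R).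
Variables (D : set R) (p : R) (omega : R -> R).
Hypotheses (mD : measurable D) (p1 : 1 < p).
Hypothesis momega : measurable_fun D omega.
Hypothesis omega_ge0 : forall t, D t -> 0 <= omega t.

Lemma dual_weight_ge0 t : (0 <= dual_weight p omega t)%E.
Proof. by rewrite /dual_weight; case: ifP => // _; rewrite lee_fin powR_ge0. Qed.

Lemma measurable_dual_weight : measurable_fun D (dual_weight p omega).
Proof.
apply: measurable_fun_if => //.
- by apply: measurable_fun_eqr => //; exact: measurable_cst.
- apply/measurable_EFinP.
  apply: (measurableT_comp (measurable_powR _)).
  by apply: measurable_funS momega => // t [].
Qed.

Let p0 : 0 < p. Proof. exact: lt_trans p1. Qed.
Let q : R := p / (p - 1).
Let p10 : 0 < p - 1. Proof. by rewrite subr_gt0. Qed.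
Let q0 : 0 < q. Proof. by rewrite divr_gt0. Qed.
Let qV : q^-1 = (p - 1) / p. Proof. by rewrite /q invf_div. Qed.
Let pqV : p^-1 + q^-1 = 1.
Proof. by rewrite qV; field; rewrite gt_eqF. Qed.

Hypothesis dual_lty : (\int[mu]_(t in D) dual_weight p omega t < +oo)%E.

(** The dual weight is [+oo] at the zeros of [omega], and an integrable function is finite almost
    everywhere. *)
Lemma ae_weight_neq0 : {ae mu, forall t, D t -> omega t != 0}.
Proof.
have idual : mu.-integrable D (dual_weight p omega).
  apply/integrableP; split; first exact: measurable_dual_weight.
  by under eq_integral do rewrite gee0_abs ?dual_weight_ge0//.
have := @integrable_ae _ _ _ mu D mD _ idual; apply: filterS => t Dt /Dt.
by rewrite /dual_weight; case: ifP.
Qed.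

(** Hoelder with exponents p and q = p / (p - 1) for |g| omega^(1/p) and omega^(-1/p). Their product
    is |g| almost everywhere, and q / p = 1 / (p - 1) turns the q-th power of the second factor into
    the dual weight. *)
Lemma weighted_hoelder (g : R -> R) : measurable_fun D g ->
  (\int[mu]_(t in D) `|g t|%:E <=
   (\int[mu]_(t in D) (`|g t| `^ p * omega t)%:E) `^ p^-1 *
   (\int[mu]_(t in D) dual_weight p omega t) `^ ((p - 1) / p))%E.
Proof.
move=> mg.
(* Both factors are cut off outside [D], since Hoelder's inequality is applied to norms over the
   whole line. *)
pose f1 := (fun t => `|g t| * omega t `^ p^-1) \_ D.
pose f2 := (fun t => omega t `^ (- p^-1)) \_ D.
have mf1' : measurable_fun D (fun t => `|g t| * omega t `^ p^-1).
  apply: measurable_funM; first exact: measurableT_comp.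
  exact: (measurableT_comp (measurable_powR _)).
have mf2' : measurable_fun D (fun t => omega t `^ (- p^-1)).
  exact: (measurableT_comp (measurable_powR _)).
have mf1 : measurable_fun setT f1 by exact/(measurable_restrictT _ mD).
have mf2 : measurable_fun setT f2 by exact/(measurable_restrictT _ mD).
have -> : (\int[mu]_(t in D) `|g t|%:E = 'N[mu]_1[EFin \o (f1 \* f2)%R])%E.
  transitivity (\int[mu]_(t in D) (`|g t| * omega t `^ p^-1 * omega t `^ (- p^-1))%:E)%E.
    apply: ae_eq_integral => //.
    - by apply/measurable_EFinP; exact: measurableT_comp.
    - by apply/measurable_EFinP; exact: measurable_funM.
    - have := ae_weight_neq0; apply: filterS; first exact: (ae_filter_ringOfSetsType mu).
      move=> t /[swap] Dt /(_ Dt) wt0.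
      by rewrite -mulrA -powRD ?wt0 ?implybT// subrr powRr0 mulr1.
  rewrite Lnorm1 [LHS]integral_mkcond; apply: eq_integral => t _ /=.
  rewrite /f1 /f2 /patch; case: ifPn => Dt; last by rewrite mulr0 normr0.
  by rewrite !normrM normr_id !(ger0_norm (powR_ge0 _ _)).
apply: (le_trans (@hoelder _ _ _ mu _ _ _ _ mf1 mf2 p0 q0 pqV)).
rewrite unlock qV; apply: lee_pmul; [exact: poweR_ge0..| |].
- rewrite [X in (_ <= X `^ _)%E]integral_mkcond le_eqVlt; apply/orP; left; apply/eqP.
  congr (_ `^ _)%E; apply: eq_integral => t _ /=.
  rewrite /f1 /patch; case: ifPn => Dt; last by rewrite normr0 powR0// gt_eqF.
  rewrite normrM normr_id (ger0_norm (powR_ge0 _ _)) powRM ?powR_ge0//.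
  by rewrite -powRrM mulVf ?gt_eqF// powRr1//; apply: omega_ge0; exact: set_mem.
- have p1p0 : 0 <= (p - 1) / p by rewrite divr_ge0 ?ltW.
  apply: gt0_ler_poweR => //.
  + by rewrite in_itv/= leey andbT; apply: integral_ge0 => t _; rewrite lee_fin powR_ge0.
  + by rewrite in_itv/= leey andbT; apply: integral_ge0 => t _; exact: dual_weight_ge0.
  (* Only an inequality holds pointwise: at a zero of [omega] in [D], [powR] gives [f2] the value 0
     whereas the dual weight is [+oo]. *)
  rewrite [leRHS]integral_mkcond; apply: ge0_le_integral => //=.
  + apply/measurable_EFinP; apply: (measurableT_comp (measurable_powR _)).
    exact: measurableT_comp.
  + by apply/(measurable_restrictT _ mD); exact: measurable_dual_weight.
  + move=> t _; rewrite /f2 /patch; case: ifPn => Dt; last by rewrite normr0 powR0// gt_eqF.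
    rewrite ger0_norm ?powR_ge0// -powRrM /dual_weight; case: ifPn => _; first exact: leey.
    rewrite lee_fin le_eqVlt; apply/orP; left; apply/eqP; congr powR.
    by rewrite /q; field; rewrite !gt_eqF.
Qed.

End weighted_hoelder.

(** * Consistency on one cell *)

Section bounded_multiplier.
Context {R : realType}.
Notation mu := (@lebesgue_measure R).

Lemma integrable_scale (I : set R) (k : R -> R) (r : R) : measurable I ->
  mu.-integrable I (EFin \o k) -> mu.-integrable I (EFin \o (fun t => r * k t)).
Proof. by move=> mI ik; exact: (@integrableZl _ _ _ mu I mI r _ ik). Qed.

Lemma integrable_sub (I : set R) (f g : R -> R) : measurable I ->
  mu.-integrable I (EFin \o f) -> mu.-integrable I (EFin \o g) ->
  mu.-integrable I (EFin \o (fun t => f t - g t)).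
Proof. by move=> mI fI gI; exact: (@integrableB _ _ _ mu I mI _ _ fI gI). Qed.

Lemma integrable_bounded_mul (I : set R) (h k : R -> R) (B : R) : measurable I ->
  measurable_fun I h -> (forall t, I t -> `|h t| <= B) ->
  mu.-integrable I (EFin \o k) -> mu.-integrable I (EFin \o (fun t => h t * k t)).
Proof.
move=> mI mh hB ik; have := integrable_scale I k B mI ik; apply: le_integrable => //.
  apply/measurable_EFinP; apply: measurable_funM => //.
  by apply/measurable_EFinP; case/integrableP: ik.
move=> t It; rewrite /= lee_fin !normrM ler_wpM2r//.
by rewrite (le_trans (hB _ It))// ler_norm.
Qed.

Lemma Rintegral_bounded_mul (I : set R) (h k : R -> R) (B : R) : measurable I ->
  measurable_fun I h -> (forall t, I t -> `|h t| <= B) ->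
  mu.-integrable I (EFin \o k) -> (forall t, I t -> 0 <= k t) ->
  `|\int[mu]_(t in I) (h t * k t)| <= B * \int[mu]_(t in I) k t.
Proof.
move=> mI mh hB ik k0; have ihk := integrable_bounded_mul I h k B mI mh hB ik.
apply: le_trans; first by apply: le_normr_Rintegral.
rewrite -RintegralZl//; apply: le_Rintegral => //.
- by have := integrable_norm ihk.
- exact: integrable_scale.
- by move=> t It; rewrite normrM (ger0_norm (k0 _ It)) ler_wpM2r ?k0// hB.
Qed.

End bounded_multiplier.

Section kernel_on_interval.
Context {R : realType}.
Notation mu := (@lebesgue_measure R).
Variables (alpha a b c : R).
Hypotheses (alpha01 : 0 < alpha < 1) (ab : a < b) (bc : b <= c).

Let k t : R := (c - t) `^ (- alpha).

Lemma integral_kernel : (\int[mu]_(t in `]a, b[) (k t)%:E =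
  (((c - a) `^ (1 - alpha) - (c - b) `^ (1 - alpha)) / (1 - alpha))%:E)%E.
Proof.
have /andP[_ a1] := alpha01.
have aE : - alpha = 1 - alpha - 1 by ring.
rewrite /k [in LHS]aE.
by apply: integral_powR_sub => //; rewrite subr_gt0.
Qed.

Lemma integrable_kernel : mu.-integrable `]a, b[ (EFin \o k).
Proof.
apply/integrableP; split.
  apply/measurable_EFinP; apply: open_continuous_measurable_fun => // t.
  rewrite inE/= in_itv/= => /andP[_ tb]; apply: continuous_powR_sub.
  exact: lt_le_trans bc.
under eq_integral do rewrite /= ger0_norm ?powR_ge0//.
by rewrite integral_kernel ltry.
Qed.

Lemma le_kernel s t : s <= t -> t < c -> k s <= k t.
Proof.
move=> st tc; have /andP[a0 _] := alpha01.
rewrite /k !powRN lef_pV2 ?posrE ?powR_gt0 ?subr_gt0//; last exact: le_lt_trans tc.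
rewrite ge0_ler_powR ?(ltW a0)// ?nnegrE ?subr_ge0 ?(ltW tc) ?lerD2l ?lerN2//.
by rewrite (le_trans st)// ltW.
Qed.

Variables (y : R -> R) (B : R).
Hypotheses (cy : {within `[a, b], continuous y}).
Hypothesis (dy : forall t, t \in `]a, b[ -> derivable y t 1).
Hypothesis (cdy : forall t, t \in `]a, b[ -> {for t, continuous y^`()%classic}).
Hypothesis (osc : forall r s, r \in `]a, b[ -> s \in `]a, b[ ->
  `|y^`()%classic s - y^`()%classic r| <= B).

Let slope : R := (y b - y a) / (b - a).
Let h t : R := slope - y^`()%classic t.

Let is_derive_y (t : R) : t \in `]a, b[ -> is_derive t 1 y (y^`()%classic t).
Proof. by move=> tab; rewrite derive1E; apply: DeriveDef => //; exact: dy. Qed.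

(** By the mean value theorem the slope is itself a value of y' inside the interval, so [h] is a
    difference of two such values. *)
Lemma slope_sub_le t : t \in `]a, b[ -> `|h t| <= B.
Proof.
move=> tab; have [x xab] := MVT ab is_derive_y cy.
move=> yE; rewrite /h /slope yE mulfK ?gt_eqF ?subr_gt0//.
exact: osc.
Qed.

Let measurable_dy : measurable_fun (`]a, b[ : set R) y^`()%classic.
Proof. by apply: open_continuous_measurable_fun => // t; rewrite inE; exact: cdy. Qed.

Let measurable_h : measurable_fun (`]a, b[ : set R) h.
Proof. exact: measurable_funB. Qed.

Let Icst (r : R) : mu.-integrable `]a, b[ (EFin \o (fun=> r)).
Proof.
apply/integrableP; split; first exact/measurable_EFinP.
rewrite integral_cst//= lebesgue_measure_itv/= lte_fin ab.
by rewrite -EFinB -EFinM ltry.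
Qed.

Let Rint1 (r : R) : \int[mu]_(t in `]a, b[) r = r * (b - a).
Proof.
rewrite Rintegral_cst//= lebesgue_measure_itv/= lte_fin ab.
by rewrite -EFinB.
Qed.

Let integrable_h : mu.-integrable `]a, b[ (EFin \o h).
Proof.
have := integrable_bounded_mul _ h (fun=> 1) B (measurable_itv _) measurable_h
  slope_sub_le (Icst 1).
by under [X in integrable _ _ (EFin \o X) -> _]eq_fun do rewrite mulr1.
Qed.

Let Rint_h : \int[mu]_(t in `]a, b[) h t = 0.
Proof.
pose F t : R := B * t - (slope * t - y t).
have h1 t : t \in `]a, b[ -> 0 <= B - h t.
  by move=> /slope_sub_le; rewrite subr_ge0; apply: le_trans; exact: ler_norm.
(* The fundamental theorem at hand needs a nonnegative integrand: B - h is one. *)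
have intBh : (\int[mu]_(t in `]a, b[) (B - h t)%:E = (F b - F a)%:E)%E.
  apply: ge0_continuous_FTC2oo; [exact: ab|exact: h1| | |].
  - move=> t tab; apply: cvgB; first exact: cvg_cst.
    by apply: cvgB; [exact: cvg_cst|exact: cdy].
  - move=> t tab; have d1 := is_derive_y t tab.
    have dl (r : R) : is_derive t 1 (fun t : R => r * t) r.
      have -> : (fun t => r * t) = (r *: id : R -> R) by [].
      by apply: is_derive_eq; rewrite [_ *: _]mulr1.
    exact: is_deriveB (dl B) (is_deriveB (dl slope) d1).
  - have cl (r : R) : {within `[a, b], continuous (fun t => r * t)}.
      by apply: continuous_subspaceT => t; apply: cvgM; [exact: cvg_cst|exact: cvg_id].
    by apply: within_continuousB => //; exact: within_continuousB.
have : \int[mu]_(t in `]a, b[) (B - h t) = B * (b - a).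
  rewrite /Rintegral intBh/= /F.
  have -> : y b = slope * (b - a) + y a by rewrite divfK ?subrK// gt_eqF// subr_gt0.
  ring.
rewrite RintegralB//.
by rewrite Rint1 => /(canRL (subKr _)); rewrite subrr.
Qed.

(** Serves the cell with b = c, where the kernel is unbounded and [k b] is the default value 0 of
    [powR], so that its increment gives no control. *)
Lemma defect_le_integral :
  `|\int[mu]_(t in `]a, b[) (h t * k t)| <=
  B * (((c - a) `^ (1 - alpha) - (c - b) `^ (1 - alpha)) / (1 - alpha)).
Proof.
have := Rintegral_bounded_mul _ h k B (measurable_itv _) measurable_h slope_sub_le
  integrable_kernel (fun t _ => powR_ge0 _ _).
by rewrite [X in _ <= _ * X -> _]/Rintegral integral_kernel.
Qed.

(* h has mean zero, so the kernel may be replaced by k - k a. *)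
Lemma defect_le_variation : b < c ->
  `|\int[mu]_(t in `]a, b[) (h t * k t)| <= B * ((k b - k a) * (b - a)).
Proof.
move=> bc'.
have ika : mu.-integrable `]a, b[ (EFin \o (fun t => k t - k a)).
  by apply: integrable_sub => //; exact: integrable_kernel.
have ihk : mu.-integrable `]a, b[ (EFin \o (fun t => h t * k t)).
  exact: (integrable_bounded_mul _ h k B (measurable_itv _) measurable_h
    slope_sub_le integrable_kernel).
have -> : \int[mu]_(t in `]a, b[) (h t * k t) = \int[mu]_(t in `]a, b[) (h t * (k t - k a)).
  under [RHS]eq_Rintegral do rewrite mulrBr.
  rewrite RintegralB//; first by rewrite RintegralZr// Rint_h mul0r subr0.
  by under [in X in integrable _ _ X]eq_fun do rewrite mulrC; exact: integrable_scale.
have k_incr t : `]a, b[%classic t -> k a <= k t <= k b.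
  rewrite /= in_itv/= => /andP[at_ tb]; rewrite !le_kernel//.
  - exact: ltW.
  - exact: ltW.
  - exact: lt_trans bc'.
have B0 : 0 <= B.
  have mab : (a + b) / 2 \in `]a, b[ by rewrite in_itv/= !midf_lt.
  exact: le_trans (slope_sub_le _ mab).
apply: (le_trans (Rintegral_bounded_mul _ h (fun t => k t - k a) B (measurable_itv _) measurable_h
  slope_sub_le ika _)).
  by move=> t /k_incr /andP[+ _]; rewrite subr_ge0.
rewrite ler_wpM2l// -Rint1; apply: le_Rintegral => //.
by move=> t /k_incr /andP[_ ktb]; rewrite lerD2r.
Qed.

End kernel_on_interval.

(** * The L1 coefficients and stability *)

Section L1_coefficients.
Context {R : realType}.
Variable alpha : R.
Hypothesis alpha01 : 0 < alpha < 1.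
Notation b := (L1_coef alpha).

Let a1 : 0 < 1 - alpha. Proof. by rewrite subr_gt0; case/andP: alpha01. Qed.

Lemma L1_coef0 : b 0 = 1.
Proof. by rewrite /L1_coef powR1 powR0 ?subr0// gt_eqF. Qed.

(** The lower bound and the monotonicity of the coefficients are both read off this mean value,
    since x^(-alpha) decreases. *)
Lemma L1_coef_mvt i : exists2 x : R, i%:R < x < i.+1%:R & b i = (1 - alpha) * x `^ (- alpha).
Proof.
have ii : i%:R < i.+1%:R :> R by rewrite ltr_nat.
have pos (x : R) : i%:R < x -> 0 < x by apply: le_lt_trans; exact: ler0n.
have [x||x xi] := @MVT R (@powR R ^~ (1 - alpha))
  (fun x => (1 - alpha) * x `^ (1 - alpha - 1)) _ _ ii.
- by rewrite in_itv/= => /andP[/pos x0 _]; exact: is_derive1_powR.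
- apply/continuous_within_itvP => //; split.
  + by move=> t; rewrite in_itv/= => /andP[/pos t0 _]; exact: continuous_powRl.
  (* For i = 0 the left end point is 0, where only continuity from the right is available. *)
  + case: i ii pos => [|i] ii pos; last by apply: cvg_at_right_filter; apply: continuous_powRl.
    by rewrite powR0 ?gt_eqF//; exact: powR_cvg0.
  + by apply: cvg_at_left_filter; apply: continuous_powRl; exact: pos.
move=> bE; exists x; first by move: xi; rewrite in_itv.
by rewrite /L1_coef bE -natrB ?leqnSn// subSnn mulr1 (_ : 1 - alpha - 1 = - alpha)//; ring.
Qed.

Let powRN_anti (x z : R) : 0 < x -> x <= z -> z `^ (- alpha) <= x `^ (- alpha).
Proof.
have /andP[a0 _] := alpha01.
move=> x0 xz; have z0 := lt_le_trans x0 xz.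
by rewrite !powRN lef_pV2 ?posrE ?powR_gt0// ge0_ler_powR ?nnegrE ?(ltW a0) ?(ltW x0) ?(ltW z0).
Qed.

Lemma L1_coef_ge i : (1 - alpha) * i.+1%:R `^ (- alpha) <= b i.
Proof.
have [x /andP[ix xi] ->] := L1_coef_mvt i.
have x0 : 0 < x by apply: le_lt_trans ix.
by rewrite ler_wpM2l ?(ltW a1)// powRN_anti// ltW.
Qed.

Lemma L1_coef_gt0 i : 0 < b i.
Proof. by apply: lt_le_trans (L1_coef_ge i); rewrite mulr_gt0// powR_gt0. Qed.

Lemma L1_coef_decr i : b i.+1 <= b i.
Proof.
have [x /andP[ix xi] ->] := L1_coef_mvt i.
have [z /andP[iz zi] ->] := L1_coef_mvt i.+1.
have x0 : 0 < x by apply: le_lt_trans ix.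
by rewrite ler_wpM2l ?(ltW a1)// powRN_anti// (le_trans (ltW xi)) ?ltW.
Qed.

Lemma L1_coef_nincr i j : (i <= j)%N -> b j <= b i.
Proof.
move=> ij; rewrite -(subnK ij) addnC; elim: (j - i)%N => [|n IH]; first by rewrite addn0.
by rewrite addnS (le_trans (L1_coef_decr _)).
Qed.

(** Summation by parts, with b_0 = 1 supplying the term [Y n]. In terms of increments the scheme is
    visibly linear and can be compared cell by cell with the Caputo integral. *)
Lemma L1_op_sum (tau : R) (Y : nat -> R) (n : nat) : (0 < n)%N ->
  L1_op alpha tau Y n = tau `^ (- alpha) / Gamma (2 - alpha) *
    \sum_(0 <= j < n) b (n - j.+1) * (Y j.+1 - Y j).
Proof.
case: n => // n _; rewrite /L1_op; congr (_ * _).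
have S1 : \sum_(0 <= j < n.+1) b (n.+1 - j.+1) * Y j.+1 =
    \sum_(1 <= i < n.+1) b (n.+1 - i) * Y i + Y n.+1.
  by rewrite big_nat_recr//= subnn L1_coef0 mul1r big_add1.
have S2 : \sum_(0 <= j < n.+1) b (n.+1 - j.+1) * Y j =
    b (n.+1 - 1) * Y 0 + \sum_(1 <= i < n.+1) b (n.+1 - i - 1) * Y i.
  by rewrite big_ltn//; congr (_ + _); apply: eq_bigr => i _; rewrite -subnDA addn1.
under [RHS]eq_bigr do rewrite mulrBr.
rewrite sumrB S1 S2; under [in LHS]eq_bigr do rewrite mulrBl.
by rewrite sumrB; ring.
Qed.

Lemma L1_opB (tau : R) (Y Z : nat -> R) (n : nat) : (0 < n)%N ->
  L1_op alpha tau (fun k => Y k - Z k) n = L1_op alpha tau Y n - L1_op alpha tau Z n.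
Proof.
move=> n0; rewrite !L1_op_sum// -mulrBr -sumrB; congr (_ * _).
by apply: eq_bigr => i _; rewrite -mulrBr; congr (_ * _); ring.
Qed.

Lemma L1_stability (tau lambda rho : R) (e : nat -> R) (N : nat) : 0 < tau ->
  0 < Gamma (2 - alpha) -> 0 <= lambda -> e 0 = 0 ->
  (forall n, (0 < n <= N)%N -> `|L1_op alpha tau e n + lambda * e n| <= rho) ->
  forall n, (0 < n <= N)%N ->
    `|e n| <= Gamma (2 - alpha) / (1 - alpha) * (n%:R * tau) `^ alpha * rho.
Proof.
move=> tau0 G0 lambda0 e0 He.
set kappa := tau `^ (- alpha) / Gamma (2 - alpha).
have kappa0 : 0 < kappa by rewrite divr_gt0// powR_gt0.
have rho0 n : (0 < n <= N)%N -> 0 <= rho by move=> /He; exact: le_trans.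
(* The weights of |e i| sum to 1 - b (n - 1), and rho / (kappa * b (n - 1))
   dominates the bounds already obtained for i < n. *)
have claim n : (0 < n <= N)%N -> kappa * b n.-1 * `|e n| <= rho.
  elim/ltn_ind: n => n IH /andP[n0 nN].
  have r0 : 0 <= rho by apply: (rho0 n); rewrite n0.
  have := He n; rewrite n0 nN /L1_op -/kappa e0 mulr0 subr0 => /(_ isT) Hn.
  set S := \sum_(1 <= i < n) _ in Hn.
  have SM : `|S| * (kappa * b n.-1) <= (1 - b n.-1) * rho.
    have -> : (1 - b n.-1) = \sum_(1 <= i < n) (b (n - i - 1) - b (n - i)).
      have := telescope_sumr (fun i => b (n - i)) n0; rewrite subnn L1_coef0 subn1 => <-.
      by apply: eq_bigr => i _; rewrite subnS subn1.
    have m0 : 0 <= kappa * b n.-1 by rewrite mulr_ge0 ?ltW ?L1_coef_gt0.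
    apply: (le_trans (ler_wpM2r m0 (ler_norm_sum _ _ _))); rewrite !mulr_suml.
    rewrite big_nat_cond [leRHS]big_nat_cond; apply: ler_sum => i; rewrite andbT => /andP[i1 iN].
    have d0 : 0 <= b (n - i - 1) - b (n - i).
      by rewrite subr_ge0 L1_coef_nincr// leq_subr.
    rewrite normrM (ger0_norm d0) -mulrA ler_wpM2l// mulrC.
    have := IH i iN; rewrite i1 (leq_trans (ltnW iN) nN) => /(_ isT); apply: le_trans.
    by rewrite ler_wpM2r// ler_wpM2l ?(ltW kappa0)// L1_coef_nincr// -!subn1 leq_sub2r// ltnW.
  (* Since lambda >= 0, the reaction term only enlarges the coefficient of [e n]. *)
  have kn : kappa * `|e n| <= rho + kappa * `|S|.
    apply: (@le_trans _ _ (`|(kappa + lambda) * e n|)).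
      rewrite normrM (@ger0_norm _ (kappa + lambda)) ?addr_ge0 ?(ltW kappa0)//.
      by rewrite ler_wpM2r// lerDl.
    have -> : (kappa + lambda) * e n = (kappa * (e n - S) + lambda * e n) + kappa * S by ring.
    apply: (le_trans (ler_normD _ _)); apply: lerD => //.
    by rewrite normrM gtr0_norm.
  have b0 := L1_coef_gt0 n.-1.
  rewrite mulrAC; apply: (@le_trans _ _ ((rho + kappa * `|S|) * b n.-1)).
    by rewrite ler_wpM2r// ltW.
  have -> : (rho + kappa * `|S|) * b n.-1 = rho * b n.-1 + `|S| * (kappa * b n.-1) by ring.
  rewrite [leRHS](_ : rho = rho * b n.-1 + (1 - b n.-1) * rho); last by ring.
  by rewrite lerD2l.
move=> n nN; have := claim n nN; have r0 := rho0 n nN.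
have /andP[n0 _] := nN; have n0R : 0 < n%:R :> R by rewrite ltr0n.
(* By [L1_coef_ge], [m] is a lower bound of [kappa * b n.-1]; its inverse is exactly the announced
   stability factor. *)
set m := kappa * ((1 - alpha) * n%:R `^ (- alpha)) => mle.
have m0 : 0 < m by rewrite /m mulr_gt0// mulr_gt0// powR_gt0.
have -> : Gamma (2 - alpha) / (1 - alpha) * (n%:R * tau) `^ alpha = m^-1.
  rewrite /m /kappa !powRN powRM ?ler0n ?(ltW tau0)//.
  by field; rewrite !gt_eqF// powR_gt0.
rewrite ler_pdivlMl//; apply: le_trans mle.
rewrite ler_wpM2r// /m ler_wpM2l ?(ltW kappa0)//.
by have := L1_coef_ge n.-1; rewrite prednK.
Qed.

End L1_coefficients.

(** * Truncation error *)

Section truncation.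
Context {R : realType}.
Notation mu := (@lebesgue_measure R).

(** Induction on [n], splitting off the last cell; grid points are null sets. *)
Lemma Rintegral_grid (t : nat -> R) (f : R -> R) (n : nat) : (forall j, t j < t j.+1) ->
  mu.-integrable `]t 0, t n[ (EFin \o f) ->
  \int[mu]_(s in `]t 0, t n[) f s = \sum_(0 <= j < n) \int[mu]_(s in `]t j, t j.+1[) f s.
Proof.
move=> tlt; elim: n => [|n IH] itf; first by rewrite set_itvoo0 Rintegral_set0 big_nil.
have t0n : t 0 <= t n.
  by elim: {IH itf} n => // n IHn; rewrite (le_trans IHn)// ltW.
have itn : mu.-integrable `]t 0, t n[ (EFin \o f).
  by apply: integrableS itf => //; apply: subset_itvl; rewrite bnd_simp ltW.
rewrite big_nat_recr//= -IH// Rintegral_itv_bndo_bndc//.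
rewrite -(@Rintegral_itvB R f (BRight (t 0)) (BLeft (t n.+1)) (t n) itf) ?bnd_simp//.
by rewrite addrC subrK.
Qed.

Variables (alpha tau : R).
Hypotheses (alpha01 : 0 < alpha < 1) (tau0 : 0 < tau).
Let t (j : nat) : R := j%:R * tau.

Let a1 : 0 < 1 - alpha. Proof. by rewrite subr_gt0; case/andP: alpha01. Qed.
Let t_lt j : t j < t j.+1. Proof. by rewrite ltr_pM2r// ltr_nat. Qed.
Let t_le i j : (i <= j)%N -> t i <= t j. Proof. by move=> ij; rewrite ler_pM2r// ler_nat. Qed.
Let tS j : t j.+1 - t j = tau.
Proof. by rewrite /t -mulrBl -natrB// subSnn mul1r. Qed.
Let t0E : t 0 = 0. Proof. exact: mul0r. Qed.

Variables (n : nat) (y : R -> R) (B M : R).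
Hypotheses (n0 : (0 < n)%N) (cy : {within `[0, t n], continuous y}).
Hypothesis (dy : forall s, s \in `]0, t n[ -> derivable y s 1).
Hypothesis (cdy : forall s, s \in `]0, t n[ -> {for s, continuous y^`()%classic}).
Hypothesis (dyM : forall s, s \in `]0, t n[ -> `|y^`()%classic s| <= M).
Hypothesis (osc : forall j, (j < n)%N -> forall r s, r \in `]t j, t j.+1[ ->
  s \in `]t j, t j.+1[ -> `|y^`()%classic s - y^`()%classic r| <= B).

Let k s : R := (t n - s) `^ (- alpha).
Let slope j : R := (y (t j.+1) - y (t j)) / (t j.+1 - t j).
Let defect j : R :=
  \int[mu]_(s in `]t j, t j.+1[) ((slope j - y^`()%classic s) * k s).

Let measurable_dy : measurable_fun (`]0, t n[ : set R) y^`()%classic.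
Proof. by apply: open_continuous_measurable_fun => // s; rewrite inE; exact: cdy. Qed.

Let tn0 : 0 < t n. Proof. by rewrite mulr_gt0// ltr0n. Qed.

(** The bound [M] on y' makes its product with the singular kernel integrable, so that the Caputo
    integral may be split over the cells. *)
Let integrable_dyk : mu.-integrable `]0, t n[ (EFin \o (fun s => y^`()%classic s * k s)).
Proof.
apply: (integrable_bounded_mul _ _ _ M) => //.
exact: (integrable_kernel alpha 0 (t n) (t n) alpha01 tn0 (lexx _)).
Qed.

Let cell_sub j : (j < n)%N -> `]t j, t j.+1[ `<=` `]0, t n[.
Proof.
move=> jn s; rewrite /= !in_itv/= => /andP[js sj].
by rewrite (le_lt_trans _ js) ?mulr_ge0 ?(ltW tau0)//= (lt_le_trans sj)// t_le.
Qed.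

Let cell_int j : (j < n)%N -> defect j = slope j *
  (((t n - t j) `^ (1 - alpha) - (t n - t j.+1) `^ (1 - alpha)) / (1 - alpha)) -
  \int[mu]_(s in `]t j, t j.+1[) (y^`()%classic s * k s).
Proof.
move=> jn; have jn' : t j.+1 <= t n by exact: t_le.
have ik := integrable_kernel alpha (t j) (t j.+1) (t n) alpha01 (t_lt j) jn'.
rewrite /defect; under eq_Rintegral do rewrite mulrBl.
rewrite RintegralB//; last 2 first.
- exact: integrable_scale.
- by apply: integrableS integrable_dyk => //; exact: cell_sub.
rewrite RintegralZl//; congr (_ * _ - _).
by rewrite /Rintegral (integral_kernel alpha _ _ _ alpha01 (t_lt j) jn').
Qed.

(** The scheme is the Caputo derivative of the piecewise linear interpolant of y: each increment
    times its coefficient is, up to normalisation, [slope j] times the integral of the kernel over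
    the cell. The prefactors agree by [GammaS] and tau^(1 - alpha) = tau * tau^(-alpha). *)
Lemma L1_op_sub_caputo : L1_op alpha tau (fun j => y (t j)) n - caputo alpha y (t n) =
  (Gamma (1 - alpha))^-1 * \sum_(0 <= j < n) defect j.
Proof.
have /andP[al0 al1] := alpha01.
have a01 : 0 < 1 - alpha <= 1 by rewrite a1/= gerBl ltW.
have G1 := Gamma_gt0 _ a01.
rewrite L1_op_sum// /caputo.
have -> : \int[mu]_(s in `]0, t n[) (y^`()%classic s / (t n - s) `^ alpha) =
    \sum_(0 <= j < n) \int[mu]_(s in `]t j, t j.+1[) (y^`()%classic s * k s).
  rewrite -Rintegral_grid//; last by rewrite t0E.
  by rewrite t0E; apply: eq_Rintegral => s _; rewrite /k powRN.
rewrite mulr_sumr mulr_sumr -sumrB mulr_sumr.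
rewrite big_nat_cond [RHS]big_nat_cond; apply: eq_bigr => j; rewrite andbT => /andP[_ jn].
rewrite (cell_int _ jn) [RHS]mulrBr; congr (_ - _).
have tE i : (i <= n)%N -> t n - t i = (n - i)%:R * tau.
  by move=> ni; rewrite /t -mulrBl natrB.
rewrite /slope tS !tE// ?(ltnW jn)// !powRM ?ler0n ?(ltW tau0)//.
rewrite /L1_coef -subSn// subSS -mulrBl (_ : 2 - alpha = (1 - alpha) + 1); last by ring.
rewrite GammaS// (_ : tau `^ (1 - alpha) = tau * tau `^ (- alpha)); last first.
  by rewrite powRD ?gt_eqF ?implybT// powRr1// ltW.
by field; rewrite !gt_eqF.
Qed.

Lemma L1_truncation : `|L1_op alpha tau (fun j => y (t j)) n - caputo alpha y (t n)| <=
  (Gamma (1 - alpha))^-1 * (1 + (1 - alpha)^-1) * tau `^ (1 - alpha) * B.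
Proof.
have /andP[al0 al1] := alpha01.
have a01 : 0 < 1 - alpha <= 1 by rewrite a1/= gerBl ltW.
have G1 := Gamma_gt0 _ a01.
rewrite L1_op_sub_caputo normrM gtr0_norm ?invr_gt0// -!mulrA ler_pM2l ?invr_gt0//.
apply: (le_trans (ler_norm_sum _ _ _)).
have cyj j : (j < n)%N -> {within `[t j, t j.+1], continuous y}.
  move=> jn; apply: continuous_subspaceW cy => s; rewrite /= !in_itv/= => /andP[js sj].
  by rewrite (le_trans _ js) ?mulr_ge0 ?(ltW tau0)//= (le_trans sj)// t_le.
have last_le j : (j < n)%N -> j.+1 = n -> `|defect j| <= B * (tau `^ (1 - alpha) / (1 - alpha)).
  move=> jn jnE.
  have := defect_le_integral alpha (t j) (t j.+1) (t n) alpha01 (t_lt j) (t_le _ _ jn)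
    y B (cyj j jn)
    (fun s sj => dy _ (cell_sub _ jn _ sj)) (fun s sj => cdy _ (cell_sub _ jn _ sj)) (osc _ jn).
  rewrite -/k -[X in `|X|]/(defect j) -jnE tS subrr [0 `^ _]powR0 ?subr0// gt_eqF//.
have prev_le j : (j.+1 < n)%N -> `|defect j| <= B * ((k (t j.+1) - k (t j)) * tau).
  move=> jn; have jn' := ltnW jn; have tjn : t j.+1 < t n by rewrite ltr_pM2r// ltr_nat.
  have := defect_le_variation alpha (t j) (t j.+1) (t n) alpha01 (t_lt j) (ltW tjn) y B (cyj j jn')
    (fun s sj => dy _ (cell_sub _ jn' _ sj)) (fun s sj => cdy _ (cell_sub _ jn' _ sj))
    (osc _ jn') tjn.
  by rewrite -[X in `|X|]/(defect j) tS.
have [m nE] : exists m, n = m.+1 by case: (n) n0 => // m _; exists m.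
have mn : (m < n)%N by rewrite nE.
rewrite [in leLHS]nE big_nat_recr//= -[(1 + _) * _]mulrC.
have B0 : 0 <= B.
  have [x xI] : exists x, x \in `]t m, t m.+1[.
    by exists ((t m + t m.+1) / 2); rewrite in_itv/= !midf_lt.
  exact: le_trans (osc _ mn _ _ xI xI).
(* [t m] is the last grid point before the singularity at [t n]; the telescoped sum
   [k (t m) - k (t 0)] is at most this value. *)
have km : k (t m) = tau `^ (- alpha) by rewrite /k nE tS.
have tauE : tau `^ (1 - alpha) = tau * tau `^ (- alpha).
  by rewrite powRD ?gt_eqF ?implybT// powRr1// ltW.
have sum_le : \sum_(0 <= j < m) `|defect j| <= B * tau `^ (1 - alpha).
  apply: (@le_trans _ _ (\sum_(0 <= j < m) (B * tau) * (k (t j.+1) - k (t j)))).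
    rewrite big_nat_cond [leRHS]big_nat_cond; apply: ler_sum => j; rewrite andbT => /andP[_ jm].
    have jn : (j.+1 < n)%N by rewrite nE ltnS.
    by apply: (le_trans (prev_le _ jn)); rewrite mulrCA -mulrA mulrC -!mulrA mulrCA.
  rewrite -mulr_sumr telescope_sumr// km tauE -mulrA ler_wpM2l// ler_pM2l//.
  by rewrite gerBl powR_ge0.
apply: (le_trans (lerD sum_le (last_le _ mn (esym nE)))).
rewrite le_eqVlt; apply/orP; left; apply/eqP; ring.
Qed.

End truncation.

(** * Weighted norms on the grid *)

Section weights_and_norms.
Context {R : realType}.
Notation mu := (@lebesgue_measure R).
Variables (T p : R) (omega : R -> R).
Hypotheses (T0 : 0 < T) (p1 : 1 < p) (homega : muckenhoupt T p omega).

Let p0 : 0 < p. Proof. exact: lt_trans p1. Qed.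
Let q0 : 0 < (p - 1) / p. Proof. by rewrite divr_gt0// subr_gt0. Qed.

Let momega : measurable_fun (`]0, T[ : set R) omega.
Proof. by have [[[]]] := homega. Qed.

Let omega_ge0 t : `]0, T[%classic t -> 0 <= omega t.
Proof. by have [[_ h] _] := homega; exact: h. Qed.

(** Take J = ]0, T[. If the dual average were infinite, the convention of [mule_infty] would make
    the product [+oo] even when the average of [omega] vanishes. *)
Lemma muckenhoupt_dual_lty : (\int[mu]_(t in `]0%R, T[) dual_weight p omega t < +oo)%E.
Proof.
have [_ ApT] := homega; rewrite ltey; apply/eqP => dualy.
move: ApT; rewrite ltNge => /negP; apply.
apply: ereal_sup_ubound; exists `]0, T[; split => //.
  by rewrite lebesgue_measure_itv/= lte_fin T0 -EFinB lte_fin subr0.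
rewrite /mule_infty {2}/average dualy lebesgue_measure_itv/= lte_fin T0/= subr0.
by rewrite gt0_muley ?lte_fin ?invr_gt0// poweRyr ?eqxx ?orbT// gt_eqF// subr_gt0.
Qed.

Variable N : nat.
Hypothesis N0 : (0 < N)%N.
Let tau : R := T / N%:R.
Let tau0 : 0 < tau. Proof. by rewrite divr_gt0// ltr0n. Qed.

Lemma cell_subset (j : nat) : (j < N)%N -> `]j%:R * tau, j.+1%:R * tau[ `<=` `]0, T[.
Proof.
move=> jN s; rewrite /= !in_itv/= => /andP[js sj].
apply/andP; split; first by rewrite (le_lt_trans _ js)// mulr_ge0// ltW.
rewrite (lt_le_trans sj)//.
by rewrite -[leRHS](@divfK _ N%:R) ?pnatr_eq0 -?lt0n// mulrC ler_wpM2l ?(ltW tau0)// ler_nat.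
Qed.

Let cell_dual_le (j : nat) : (j < N)%N ->
  (\int[mu]_(s in `](j%:R * tau)%R, (j.+1%:R * tau)%R[) dual_weight p omega s <=
   \int[mu]_(s in `]0%R, T[) dual_weight p omega s)%E.
Proof.
move=> jN; apply: ge0_subset_integral => //.
- exact: measurable_dual_weight.
- by move=> s _; exact: dual_weight_ge0.
- exact: cell_subset.
Qed.

Let cell_dual_ge0 (D : set R) : (0 <= \int[mu]_(s in D) dual_weight p omega s)%E.
Proof. by apply: integral_ge0 => s _; exact: dual_weight_ge0. Qed.

Lemma Lambda_ge0 : (0 <= Lambda p omega tau N)%E.
Proof.
apply: (@le_trans _ _ _ _ _ (poweR_ge0 _ _)).
by apply: ereal_sup_ubound; exists (Ordinal N0).
Qed.

Lemma Lambda_lty : (Lambda p omega tau N < +oo)%E.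
Proof.
apply: (@le_lt_trans _ _ (((tau^-1)%:E *
  \int[mu]_(s in `]0%R, T[) dual_weight p omega s) `^ ((p - 1) / p))%E).
  apply: ub_ereal_sup => _ [j _ <-]; apply: gt0_ler_poweR; first exact: ltW.
  - by rewrite in_itv/= leey andbT mule_ge0// lee_fin invr_ge0 ltW.
  - by rewrite in_itv/= leey andbT mule_ge0// lee_fin invr_ge0 ltW.
  - by rewrite lee_wpmul2l ?lee_fin ?invr_ge0 ?(ltW tau0)//; exact: cell_dual_le.
apply: poweR_lty; rewrite lte_mul_pinfty ?lee_fin ?invr_ge0 ?(ltW tau0)//.
exact: muckenhoupt_dual_lty.
Qed.

(** [Lambda] is built from averages over cells; undoing the factor 1 / tau under the exponent (p -
    1) / p yields the power of tau gained from the weight. *)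
Lemma cell_dual_le_Lambda (j : nat) : (j < N)%N ->
  ((\int[mu]_(s in `](j%:R * tau)%R, (j.+1%:R * tau)%R[) dual_weight p omega s) `^ ((p - 1) / p)
   <= (tau `^ ((p - 1) / p))%:E * Lambda p omega tau N)%E.
Proof.
move=> jN; set I := (\int[mu]_(s in _) _)%E.
have -> : I = (tau%:E * ((tau^-1)%:E * I))%E.
  by rewrite muleA -EFinM divff ?gt_eqF// mul1e.
rewrite poweRM; last 2 first.
- by rewrite lee_fin ltW.
- by rewrite mule_ge0 ?lee_fin ?invr_ge0 ?(ltW tau0)//; exact: cell_dual_ge0.
rewrite poweR_EFin lee_wpmul2l ?lee_fin ?powR_ge0//.
by apply: ereal_sup_ubound; exists (Ordinal jN).
Qed.

Variables (s : nat) (y : R -> R).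
Hypothesis sob : weighted_sobolev `]0, T[ s p omega y.
Local Notation dk := (weak_derivative `]0, T[ ^~ y).

Let mdk k : (k <= s)%N -> measurable_fun (`]0, T[ : set R) (dk k).
Proof. by move=> ks; have [_ []] := sob _ ks. Qed.

Let mterm k : (k <= s)%N ->
  measurable_fun (`]0, T[ : set R) (fun t => `|dk k t| `^ p * omega t).
Proof.
move=> ks; apply: measurable_funM => //.
apply: (measurableT_comp (measurable_powR _)).
by apply: measurableT_comp => //; exact: mdk.
Qed.

Let sumE t : ((\sum_(k < s.+1) `|dk k t| `^ p) * omega t)%:E =
  (\sum_(k < s.+1) (`|dk k t| `^ p * omega t)%:E)%E.
Proof. by rewrite mulr_suml sumEFin. Qed.

Lemma sobolev_norm_lty : (sobolev_norm `]0%R, T[ s p omega y < +oo)%E.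
Proof.
apply: poweR_lty; under eq_integral do rewrite sumE.
rewrite ge0_integral_sum//=; last 2 first.
- by move=> k; apply/measurable_EFinP; apply: mterm; rewrite -ltnS.
- by move=> k t tD; rewrite lee_fin mulr_ge0 ?powR_ge0// omega_ge0.
by apply: lte_sum_pinfty => k _; have [_ []] := sob k (ltn_ord k).
Qed.

Lemma weak_derivative_le_sobolev_norm (k : nat) (D : set R) : (k <= s)%N ->
  measurable D -> D `<=` `]0, T[ ->
  ((\int[mu]_(t in D) (`|dk k t| `^ p * omega t)%:E) `^ p^-1 <=
   sobolev_norm `]0%R, T[ s p omega y)%E.
Proof.
move=> ks mD DT; apply: gt0_ler_poweR; first by rewrite invr_ge0 ltW.
- rewrite in_itv/= leey andbT; apply: integral_ge0 => t /DT tD.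
  by rewrite lee_fin mulr_ge0 ?powR_ge0// omega_ge0.
- rewrite in_itv/= leey andbT; apply: integral_ge0 => t tD.
  by rewrite lee_fin mulr_ge0 ?sumr_ge0 ?omega_ge0// => i _; exact: powR_ge0.
apply: (@le_trans _ _ (\int[mu]_(t in `]0%R, T[) (`|dk k t| `^ p * omega t)%:E)%E).
  apply: ge0_subset_integral => //; first by apply/measurable_EFinP; exact: mterm.
  by move=> t tD; rewrite lee_fin mulr_ge0 ?powR_ge0// omega_ge0.
apply: ge0_le_integral => //=.
- by move=> t tD; rewrite lee_fin mulr_ge0 ?powR_ge0// omega_ge0.
- by apply/measurable_EFinP; exact: mterm.
- under [X in measurable_fun _ X]eq_fun do rewrite sumE.
  by apply: emeasurable_sum => i; apply/measurable_EFinP; apply: mterm; rewrite -ltnS.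
move=> t tD; rewrite lee_fin ler_wpM2r ?omega_ge0//.
rewrite (bigD1 (Ordinal (ks : (k < s.+1)%N)))//= lerDl.
by apply: sumr_ge0 => i _; exact: powR_ge0.
Qed.

(** [weighted_hoelder] on one cell, with the factor containing [omega] enlarged to the full norm.
    For k = s = 2 it bounds the oscillation of y' on the cell. *)
Lemma cell_weak_derivative_le (k j : nat) : (k <= s)%N -> (j < N)%N ->
  (\int[mu]_(t in `](j%:R * tau)%R, (j.+1%:R * tau)%R[) `|dk k t|%:E <=
   sobolev_norm `]0%R, T[ s p omega y * ((tau `^ (1 - 1 / p))%:E * Lambda p omega tau N))%E.
Proof.
move=> ks jN; have sub := cell_subset j jN.
have mI : measurable `]j%:R * tau, j.+1%:R * tau[%classic by exact: measurable_itv.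
have mo : measurable_fun (`]j%:R * tau, j.+1%:R * tau[ : set R) omega.
  exact: measurable_funS momega.
have md : measurable_fun (`]j%:R * tau, j.+1%:R * tau[ : set R) (dk k).
  by apply: measurable_funS (mdk _ ks).
apply: le_trans.
  apply: (weighted_hoelder _ p omega mI p1 mo _ _ _ md).
    by move=> t /sub; exact: omega_ge0.
  exact: le_lt_trans (cell_dual_le _ jN) muckenhoupt_dual_lty.
have -> : 1 - 1 / p = (p - 1) / p by field; rewrite gt_eqF.
apply: lee_pmul; [exact: poweR_ge0|exact: poweR_ge0| |exact: cell_dual_le_Lambda].
exact: weak_derivative_le_sobolev_norm.
Qed.

End weights_and_norms.

(** * Global error estimate *)

(** The extension [dy] is continuous on the compact interval [0, T], hence bounded, and y' agrees
    with it near every interior point. *)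
Lemma C1_representative_continuous_derive1 {R : realType} (T : R) (y : R -> R) :
  0 < T -> C1_representative T y ->
  (forall t, t \in `]0, T[ -> {for t, continuous y^`()%classic}) /\
  exists M, forall t, t \in `]0, T[ -> `|y^`()%classic t| <= M.
Proof.
move=> T0 [_ _ [dy [cdy _ dyE]]]; split.
  move=> t tT; have [/(_ t tT) ct _ _] := (continuous_within_itvP dy T0).1 cdy.
  have near_dy : \forall s \near t, dy s = y^`()%classic s.
    by near=> s; rewrite dyE//; near: s; exact: near_in_itvoo.
  have : y^`()%classic x @[x --> t] --> dy t.
    by apply: cvg_trans ct; exact: near_eq_cvg.
  by rewrite -(dyE t tT).
have [c _ cmax] := EVT_max (ltW T0) (within_continuous_norm _ _ cdy).
exists `|dy c| => t tT; rewrite dyE//; apply: cmax.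
exact: subset_itv_oo_cc.
Unshelve. all: by end_near. Qed.

Theorem theorem2 (R : realType) (alpha p T lambda : R) (omega : R -> R)
  (halpha : 0 < alpha < 1) (hp : 1 < p) (hT : 0 < T) (hlambda : 0 <= lambda)
  (homega : muckenhoupt T p omega) :
  exists2 C : R, 0 < C &
    forall (f y : R -> R) (y0 : R),
      {within `[0, T], continuous f} ->
      exact_solution alpha lambda T y0 f y ->
      weighted_sobolev `]0, T[ 2 p omega y ->
      C1_representative T y ->
      forall (N : nat) (Y : nat -> R), (1 <= N)%N ->
        let tau := T / N%:R in
        numerical_solution alpha lambda tau y0 f N Y ->
        ((\big[Num.max/0]_(1 <= n < N.+1) `|y (n%:R * tau) - Y n|)%:E <=
         (C * tau `^ (2 - alpha - 1 / p))%:E * Lambda p omega tau N *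
         sobolev_norm `]0%R, T[ 2 p omega y)%E.
Proof.
have /andP[al0 al1] := halpha.
have a01 : 0 < 1 - alpha <= 1 by rewrite subr_gt0 al1 gerBl ltW.
have a0 : 0 < 1 - alpha by case/andP: a01.
have G1 := Gamma_gt0 _ a01.
have G2 : 0 < Gamma (2 - alpha).
  by rewrite (_ : 2 - alpha = 1 - alpha + 1) ?GammaS ?mulr_gt0//; ring.
(* [K] is the constant of [L1_truncation]: 1 for the telescoping cells, 1 / (1 - alpha) for the last
   one. [C] multiplies it by the stability factor at time T, which dominates those at all t_n. *)
pose K := (Gamma (1 - alpha))^-1 * (1 + (1 - alpha)^-1).
have K0 : 0 < K by rewrite mulr_gt0 ?invr_gt0// addr_gt0 ?invr_gt0.
pose C := Gamma (2 - alpha) / (1 - alpha) * T `^ alpha * K.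
have C0 : 0 < C by rewrite mulr_gt0// mulr_gt0 ?powR_gt0// divr_gt0.
exists C => //.
move=> f y y0 _ [hy y00] sob C1 N Y N0 tau [Y0 hY].
have tau0 : 0 < tau by rewrite divr_gt0// ltr0n.
have NtauT : N%:R * tau = T by rewrite mulrC divfK// pnatr_eq0 -lt0n.
have [cy dy _] := C1.
have [cdy [M dyM]] := C1_representative_continuous_derive1 T y hT C1.
have [L0 Ly] := (Lambda_ge0 T p omega N N0, Lambda_lty T p omega hT hp homega N N0).
have Sy := sobolev_norm_lty T p omega homega 2 y sob.
have S0 : (0 <= sobolev_norm `]0%R, T[ 2 p omega y)%E by exact: poweR_ge0.
have cell := cell_weak_derivative_le T p omega hT hp homega N N0 2 y sob 2.
(* [Lambda] and the norm are finite and nonnegative, so the rest is an estimate between reals. *)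
move: L0 Ly Sy S0 cell; rewrite -/tau.
case: (Lambda p omega tau N) => [L| |]//; case: (sobolev_norm _ _ _ _ _) => [S| |]//.
rewrite !lee_fin => L0 _ _ S0 cell.
pose B := S * (tau `^ (1 - 1 / p) * L).
have wd : is_weak_derivative `]0, T[ 2 y (weak_derivative `]0, T[ 2 y).
  by apply: xgetPex; have [] := sob 2%N (leqnn _).
have le_T j : (j <= N)%N -> j%:R * tau <= T.
  by move=> jN; rewrite -NtauT ler_wpM2r ?(ltW tau0)// ler_nat.
have osc j : (j < N)%N -> forall r s, r \in `]j%:R * tau, j.+1%:R * tau[ ->
    s \in `]j%:R * tau, j.+1%:R * tau[ -> `|y^`()%classic s - y^`()%classic r| <= B.
  move=> jN r s rI sI; rewrite -lee_fin.
  apply: le_trans (cell j (leqnn _) jN).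
  apply: weak_derivative2_osc wd dy cdy _ _ _ _ _ _ rI sI; last exact: le_T.
  by rewrite mulr_ge0// ltW.
pose e k := y (k%:R * tau) - Y k.
have e0 : e 0 = 0 by rewrite /e mul0r y00 Y0 subrr.
have trunc n : (0 < n <= N)%N -> `|L1_op alpha tau e n + lambda * e n| <=
    K * tau `^ (1 - alpha) * B.
  move=> /andP[n0 nN].
  have tn_in : n%:R * tau \in `]0, T] by rewrite in_itv/= mulr_gt0 ?ltr0n//= le_T.
  (* By linearity of the scheme, f(t_n) and the lambda terms cancel. *)
  have -> : L1_op alpha tau e n + lambda * e n =
      L1_op alpha tau (fun k => y (k%:R * tau)) n - caputo alpha y (n%:R * tau).
    rewrite L1_opB// /e; have := hY n; rewrite n0 nN => /(_ isT) hYn.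
    by have := hy _ tn_in; rewrite -hYn => hyn; rewrite mulrBr; lra.
  have sub s : s \in `]0, n%:R * tau[ -> s \in `]0, T[.
    by rewrite !in_itv/= => /andP[-> /lt_le_trans->//]; exact: le_T.
  apply: (L1_truncation alpha tau halpha tau0 n y B M n0).
  - apply: continuous_subspaceW cy => s; rewrite /= !in_itv/= => /andP[-> sn].
    by rewrite (le_trans sn)// le_T.
  - by move=> s /sub; exact: dy.
  - by move=> s /sub; exact: cdy.
  - by move=> s /sub; exact: dyM.
  - by move=> j jn; apply: osc; exact: leq_trans nN.
have stab := L1_stability alpha halpha tau lambda _ e N tau0 G2 hlambda e0 trunc.
have B0 : 0 <= B by rewrite !mulr_ge0// powR_ge0.
(* The maximum has default value 0, so the bound must be nonnegative as well. *)
rewrite big_nat_cond; apply: bigmax_le.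
  by rewrite mulr_ge0// mulr_ge0// mulr_ge0 ?powR_ge0 ?(ltW C0).
move=> n; rewrite andbT ltnS => nN; apply: (le_trans (stab n nN)).
have -> : C * tau `^ (2 - alpha - 1 / p) * L * S =
    Gamma (2 - alpha) / (1 - alpha) * T `^ alpha * (K * tau `^ (1 - alpha) * B).
  have -> : tau `^ (2 - alpha - 1 / p) = tau `^ (1 - alpha) * tau `^ (1 - 1 / p).
    by rewrite -powRD ?(gt_eqF tau0) ?implybT//; congr powR; ring.
  rewrite /C /B; move: (tau `^ _) (tau `^ _) (T `^ _) (Gamma _) => *; ring.
have ge0 : 0 <= K * tau `^ (1 - alpha) * B by rewrite mulr_ge0// mulr_ge0 ?powR_ge0 ?(ltW K0).
rewrite ler_wpM2r// ler_wpM2l ?divr_ge0 ?(ltW G2) ?(ltW a0)//.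
have /andP[n0 nN'] := nN.
apply: ge0_ler_powR; rewrite ?(ltW al0) ?nnegrE ?(ltW hT)//.
  by rewrite mulr_ge0// ltW.
exact: le_T.
Qed.
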